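(* Let $(\sigma,\eta,\rho)$ be Blaschke interpolation data of type $(n,k)$. Let $x$ be a solution of the royal tetra-interpolation problem with data $(\sigma,\eta,\tilde\eta,\rho)$ for some $\tilde\eta_j\in\overline{\mathbb D}$, $j=1,\dots,n$, and suppose that $x(\overline{\mathbb D})\nsubseteq\mathcal R_{\overline{\mathcal E}}$. Then for all $\omega\in\mathbb T\setminus\{\overline{\tilde\eta_1},\dots,\overline{\tilde\eta_k}\}$, the function $\varphi=\Psi_\omega\circ x$ is a solution of the Blaschke interpolation problem with data $(\sigma,\eta,\rho)$. Conversely, for every solution $\varphi$ of the Blaschke interpolation problem with data $(\sigma,\eta,\rho)$, there exists $\omega\in\mathbb T$ such that $\varphi=\Psi_\omega\circ x$.
   Context: $\mathbb D$ is the open unit disc in $\mathbb C$, $\overline{\mathbb D}$ its closure, $\mathbb T$ the unit circle. Closed tetrablock: $\overline{\mathcal E}=\{(x_1,x_2,x_3)\in\mathbb C^3: 1-x_1z-x_2w+x_3zw\neq 0 \text{ whenever } |z|<1,|w|<1\}$. Its distinguished boundary (smallest closed boundary) is $b\overline{\mathcal E}=\{x\in\mathbb C^3: x_1=\overline{x_2}x_3,\ |x_3|=1,\ |x_2|\le 1\}$. Royal variety: $\mathcal R_{\overline{\mathcal E}}=\{(x_1,x_2,x_3)\in\overline{\mathcal E}: x_3=x_1x_2\}$. A rational $\overline{\mathcal E}$-inner (or tetra-inner) function is an analytic map $x=(x_1,x_2,x_3):\mathbb D\to\overline{\mathcal E}$ with rational components such that $\lim_{r\uparrow1}x(r\lambda)\in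 b\overline{\mathcal E}$ for almost all $\lambda\in\mathbb T$; it extends continuously to $\overline{\mathbb D}$. Its degree is the topological degree of $x|_{\mathbb T}:\mathbb T\to b\overline{\mathcal E}$ (where $\pi_1(b\overline{\mathcal E})\cong\mathbb Z$); it equals the degree of the finite Blaschke product $x_3$. For $\omega\in\mathbb T$, $\Psi_\omega(x_1,x_2,x_3)=\frac{x_3\omega-x_1}{x_2\omega-1}$ when $x_2\omega\ne1$; $\Psi_\omega\circ x$ is regarded as a rational function on $\overline{\mathbb D}$. Phasar derivative: if $f$ is a differentiable function on $\mathbb T$, nonvanishing near $z=e^{i\theta}$, $Af(z)$ denotes the derivative with respect to $\theta$ of $\arg f(e^{i\theta})$ at $z$. Blaschke interpolation data of type $(n,k)$, $n\ge1$, $0\le k\le n$: a triple $(\sigma,\eta,\rho)$ where $\sigma=(\sigma_1,\dots,\sigma_n)$ consists of distinct points with $\sigma_j\in\mathbb T$ for $j\le k$ and $\sigma_j\in\mathbb D$ for $j>k$; $\eta=(\eta_1,\dots,\eta_n)$ with $\eta_j\in\mathbb T$ for $j\le k$ and $\eta_j\in\mathbb D$ for $j>k$; $\rho=(\rho_1,\dots,\rho_k)$ with $\rho_j>0$. Royal tetra-interpolation data of type $(n,k)$: a four-tuple $(\sigma,\eta,\tilde\eta,\rho)$ where $(\sigma,\eta,\rho)$ is Blaschke interpolation data of type $(n,k)$ and $\tilde\eta=(\tilde\eta_1,\dots,\tilde\eta_n)$ with $\tilde\eta_j\in\mathbb T$ for $j\le k$ and $\tilde\eta_j\in\mathbb D$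 for $j>k$. Blaschke interpolation problem: find all rational inner functions $\varphi$ on $\mathbb D$ (finite Blaschke products) of degree $n$ with $\varphi(\sigma_j)=\eta_j$ for $j=1,\dots,n$ and $A\varphi(\sigma_j)=\rho_j$ for $j=1,\dots,k$. Royal tetra-interpolation problem: find all rational $\overline{\mathcal E}$-inner functions $x=(x_1,x_2,x_3)$ of degree $n$ with $x(\sigma_j)=(\eta_j,\tilde\eta_j,\eta_j\tilde\eta_j)$ for $j=1,\dots,n$ and $Ax_1(\sigma_j)=\rho_j$ for $j=1,\dots,k$. *)

(* Defs.v *)
From HB Require Import structures.
From mathcomp Require Import all_boot all_order all_algebra.
From mathcomp Require Import all_classical all_reals all_analysis.
From mathcomp Require Import complex.
Set Implicit Arguments.
Unset Strict Implicit.
Unset Printing Implicit Defensive.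
Import Order.TTheory GRing.Theory Num.Theory.
Import numFieldNormedType.Exports.
Local Open Scope classical_set_scope.
Local Open Scope ring_scope.

(* R[i], retyped as a numClosedFieldType: MathComp-Analysis attaches its
   topology and normed module structure to that sort, not to [complex R]. *)
Definition C (R : realType) : numClosedFieldType := R[i].

Notation C3 R := (C R * C R * C R)%type.

Definition rc {R : realType} (r : R) : C R := Complex r 0.

Definition cis {R : realType} (t : R) : C R := Complex (cos t) (sin t).

Definition disc {R : realType} : set (C R) := [set z | `|z| < 1].
Definition closed_disc {R : realType} : set (C R) := [set z | `|z| <= 1].
Definition circle {R : realType} : set (C R) := [set z | `|z| = 1].

(* A triple (x1, x2, x3) has x1 = x.1.1, x2 = x.1.2, x3 = x.2. *)
Definition closed_tetrablock {R : realType} : set (C3 R) :=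
  [set x | forall z w, disc z -> disc w ->
     1 - x.1.1 * z - x.1.2 * w + x.2 * z * w != 0].

Definition dist_boundary {R : realType} : set (C3 R) :=
  [set x | [/\ x.1.1 = x.1.2^* * x.2, `|x.2| = 1 & `|x.1.2| <= 1]].

Definition royal_variety {R : realType} : set (C3 R) :=
  [set x | closed_tetrablock x /\ x.2 = x.1.1 * x.1.2].

Definition analytic_on_disc {R : realType} (f : C R -> C R) : Prop :=
  forall z, disc z -> derivable f z 1.

(* The fraction p / q need not be reduced, so nothing is required at the
   finitely many zeros of q; in every use below f is moreover continuous on A,
   which makes these points removable. *)
Definition rational_on {R : realType} (A : set (C R)) (f : C R -> C R) : Prop :=
  exists p q : {poly C R}, q != 0 /\
    forall z, A z -> q.[z] != 0 -> f z = p.[z] / q.[z].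

(* A rational tetra-inner function is identified with its continuous extension
   to the closed disc; the values of x outside the closed disc are irrelevant.
   Almost every point of the circle is taken with respect to Lebesgue measure
   on the angle. *)
Definition tetra_inner {R : realType} (x : C R -> C3 R) : Prop :=
  [/\ [/\ analytic_on_disc (fun z => (x z).1.1),
          analytic_on_disc (fun z => (x z).1.2)
        & analytic_on_disc (fun z => (x z).2)],
      [/\ rational_on disc (fun z => (x z).1.1),
          rational_on disc (fun z => (x z).1.2)
        & rational_on disc (fun z => (x z).2)],
      forall z, disc z -> closed_tetrablock (x z),
      {ae @lebesgue_measure R, forall t : R, 0 <= t <= 2 * pi ->
         exists2 l, dist_boundary l & x (rc r * cis t) @[r --> (1 : R)^'-] --> l}
    & {within closed_disc, continuous x}].

(* Topological degree of the restriction of x to the circle. The loop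
   z |-> (0, 0, z) generates the fundamental group of the distinguished
   boundary (a solid torus); as this group is abelian, based and free homotopy
   classes of loops coincide, and x has degree d iff it is homotopic, inside
   the distinguished boundary, to the d-th power z |-> (0, 0, z ^ d). *)
Definition tetra_degree {R : realType} (x : C R -> C3 R) (d : int) : Prop :=
  exists H : R * C R -> C3 R,
    [/\ {within [set sz | 0 <= sz.1 <= 1 /\ circle sz.2], continuous H},
        forall s z, 0 <= s <= 1 -> circle z -> dist_boundary (H (s, z)),
        forall z, circle z -> H (0, z) = x z
      & forall z, circle z -> H (1, z) = (0, 0, z ^ d)].

Definition Psi {R : realType} (omega : C R) (x : C3 R) : C R :=
  (x.2 * omega - x.1.1) / (x.1.2 * omega - 1).

(* phi is the rational function Psi_omega o x on the closed disc, its removable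
   singularities being removed. The second condition excludes the case where
   Psi_omega o x is defined nowhere. *)
Definition is_Psi_comp {R : realType} (omega : C R) (x : C R -> C3 R)
    (phi : C R -> C R) : Prop :=
  [/\ rational_on closed_disc phi /\ {within closed_disc, continuous phi},
      exists2 z, disc z & (x z).1.2 * omega != 1
    & forall z, closed_disc z -> (x z).1.2 * omega != 1 ->
        phi z = Psi omega (x z)].

(* Af(z) = r: some branch a of the argument of f(e^{it}), defined for t near
   an angle t0 of z, has derivative r at t0. *)
Definition phasar_derivative {R : realType} (f : C R -> C R) (z : C R) (r : R) :
    Prop :=
  exists (t0 : R) (a : R -> R),
    [/\ z = cis t0,
        \forall t \near t0,
          f (cis t) != 0 /\ f (cis t) = `|f (cis t)| * cis (a t)
      & is_derive t0 1 a r].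

(* Rational inner functions of degree n, as functions on the closed disc. *)
Definition finite_blaschke {R : realType} (n : nat) (phi : C R -> C R) : Prop :=
  exists (c : C R) (a : 'I_n -> C R),
    [/\ circle c, forall i, disc (a i)
      & forall z, closed_disc z ->
          phi z = c * \prod_(i < n) ((z - a i) / (1 - (a i)^* * z))].

Definition blaschke_data {R : realType} (n k : nat) (hkn : (k <= n)%N)
    (sigma eta : 'I_n -> C R) (rho : 'I_k -> R) : Prop :=
  [/\ (1 <= n)%N, injective sigma,
      forall j : 'I_n, (j < k)%N -> circle (sigma j) /\ circle (eta j),
      forall j : 'I_n, (k <= j)%N -> disc (sigma j) /\ disc (eta j)
    & forall j : 'I_k, 0 < rho j].

Definition blaschke_solution {R : realType} (n k : nat) (hkn : (k <= n)%N)
    (sigma eta : 'I_n -> C R) (rho : 'I_k -> R) (phi : C R -> C R) : Prop :=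
  [/\ finite_blaschke n phi,
      forall j : 'I_n, phi (sigma j) = eta j
    & forall j : 'I_k,
        phasar_derivative phi (sigma (widen_ord hkn j)) (rho j)].

Definition royal_solution {R : realType} (n k : nat) (hkn : (k <= n)%N)
    (sigma eta etat : 'I_n -> C R) (rho : 'I_k -> R) (x : C R -> C3 R) : Prop :=
  [/\ tetra_inner x, tetra_degree x n%:Z,
      forall j : 'I_n, x (sigma j) = (eta j, etat j, eta j * etat j)
    & forall j : 'I_k,
        phasar_derivative (fun z => (x z).1.1) (sigma (widen_ord hkn j))
          (rho j)].

(* Main.v *)
(** On the circle |x3| = 1 and x1 = conj(x2) x3. Clearing denominators,
   x = (E~ / D, E / D, D~ / D), where D and E are polynomials of degree at most
   n, D has no zero in the closed disc, and p~(z) = z^n conj(p(1 / conj z)); here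
   the topological degree n of x enters as the winding number of x3 = D~ / D.

   The royal nodes are the zeros of the royal polynomial R = D~ D - E~ E, which
   is equal to its own reflection R~ (of formal degree 2n) and is equal to
   z^n (|D|^2 - |E|^2) on the circle. As |E| <= |D|, the zeros of R on the circle
   are double, so the n nodes sigma_j and their reflections exhaust the 2n zeros
   of R: every polynomial of degree at most 2n with these zeros is a multiple
   of R.

   If omega is not an excluded value, omega E - D has no zero in the closed disc,
   hence Psi_omega o x is a Blaschke product of degree n. It takes the value eta_j
   at sigma_j, and Psi_omega o x - x1 = omega R / (D (omega E - D)) has a double
   zero at the nodes of the circle, so both functions have the same phasar
   derivative there.

   Conversely, let phi = c F~ / F be a solution. The numerators
   A = c F~ D - E~ F of phi - x1 and B = c F~ E - D~ F of phi x2 - x3 vanish at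
   the nodes, A doubly so on the circle, and A~ = - conj(c) B. Hence
   A = alpha R and B = - c conj(alpha) R, so that phi - x1 = omega (phi x2 - x3)
   with omega = - alpha / (c conj(alpha)), which means phi = Psi_omega o x. *)
Require Import Defs.
From mathcomp Require Import all_boot all_order all_algebra.
From mathcomp Require Import all_classical all_reals all_analysis.
From mathcomp Require Import complex.
From mathcomp Require Import ring lra zify.
Import Order.TTheory GRing.Theory Num.Theory.
Import numFieldNormedType.Exports.
Set Implicit Arguments.
Unset Strict Implicit.
Unset Printing Implicit Defensive.
Local Open Scope classical_set_scope.
Local Open Scope ring_scope.

(** * Reflection of polynomials in the unit circle *)

Section Reversal.
Variable K : numClosedFieldType.
Implicit Types (p q u v : {poly K}) (z a c : K) (N M n : nat).

(** The reflection p~ for the formal degree [N], which may exceed the degree of [p]: a zero of [p]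
    at infinity then becomes a zero of p~ at 0. *)
Definition conj_rev N p : {poly K} := \poly_(i < N.+1) (p`_(N - i))^*.

Lemma size_conj_rev N p : (size (conj_rev N p) <= N.+1)%N.
Proof. exact: size_poly. Qed.

Lemma horner_conj_rev N p z : (size p <= N.+1)%N -> z != 0 ->
  (conj_rev N p).[z] = z ^+ N * (p.[(z^*)^-1])^*.
Proof.
move=> hp z0; rewrite /conj_rev horner_poly (horner_coef_wide _ hp) rmorph_sum.
rewrite big_distrr /= (reindex_inj rev_ord_inj) /=; apply: eq_bigr => i _.
rewrite subSS rmorphM rmorphXn fmorphV /= conjCK mulrCA; congr (_ * _).
  by rewrite subKn // -ltnS ltn_ord.
by rewrite expfB_cond ?(negbTE z0) ?add0n ?exprVn // -ltnS ltn_ord.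
Qed.

Lemma circle_conjV z : `|z| = 1 -> (z^*)^-1 = z.
Proof.
move=> z1; have z0 : z != 0 by rewrite -normr_gt0 z1.
have := normCK z; rewrite z1 expr1n => /esym zz.
by rewrite -[RHS]invrK; congr (_^-1); apply: (mulfI z0); rewrite mulfV.
Qed.

Lemma circle_neq0 z : `|z| = 1 -> z != 0.
Proof. by move=> z1; rewrite -normr_gt0 z1. Qed.

Lemma circle_mulJ z : `|z| = 1 -> z * z^* = 1.
Proof. by move=> z1; rewrite -normCK z1 expr1n. Qed.

Lemma conj_rev_circle N p z : (size p <= N.+1)%N -> `|z| = 1 ->
  (conj_rev N p).[z] = z ^+ N * (p.[z])^*.
Proof.
by move=> hp z1; rewrite horner_conj_rev ?circle_neq0 // circle_conjV.
Qed.

(** The Cayley transforms of the natural numbers are distinct points of the circle, in every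
    [numClosedFieldType]. *)
Lemma circle_infinite N : exists s : seq K,
  [/\ uniq s, size s = N & {in s, forall z, `|z| = 1}].
Proof.
pose f (m : nat) : K := (1 + 'i * m%:R) / (1 - 'i * m%:R).
have cj m : (1 + 'i * m%:R)^* = 1 - 'i * m%:R :> K.
  by rewrite rmorphD rmorph1 rmorphM /= conjCi conjC_nat mulNr.
have nz m : 1 - 'i * m%:R != 0 :> K.
  apply/eqP => h; have : 'Re (1 - 'i * m%:R) = 1 :> K.
    by rewrite -mulrN -mulrC -[1 + _]/(1 + - m%:R * 'i) mulrC
      Re_rect ?rpredN ?realn ?rpred1.
  by rewrite h raddf0 => /esym/eqP; rewrite oner_eq0.
have fi : injective f.
  move=> m1 m2 /eqP; rewrite eqr_div //; set x := 'i * _; set y := 'i * _.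
  rewrite -subr_eq0 (_ : _ - _ = (x - y) * 2); last first.
    by rewrite !mulrDl !mulrDr; set w := x * y; rewrite /=; ring.
  rewrite mulf_eq0 pnatr_eq0 orbF subr_eq0 => /eqP/(mulfI (@neq0Ci K)) /eqP.
  by rewrite eqr_nat => /eqP.
exists [seq f m | m <- iota 0 N]; split.
- by rewrite map_inj_uniq ?iota_uniq.
- by rewrite size_map size_iota.
- move=> z /mapP[m _ ->]; rewrite normf_div -cj norm_conjC divff //.
  by rewrite -norm_conjC cj normr_eq0.
Qed.

(** Identities between reflections are checked on the circle, where reflection is conjugation up to
    the factor [z ^+ N]; they then hold everywhere, because the circle is infinite. *)
Lemma poly_eq_circle p q : (forall z, `|z| = 1 -> p.[z] = q.[z]) -> p = q.
Proof.
move=> h; apply/eqP; rewrite -subr_eq0; apply/eqP.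
have [s [us ss cs]] := circle_infinite (size (p - q)).
apply: (@roots_geq_poly_eq0 _ _ s) => //; last by rewrite ss.
by apply/allP => z /cs/h e; rewrite /root !hornerE e subrr.
Qed.


Lemma conj_revM N M p q : (size p <= N.+1)%N -> (size q <= M.+1)%N ->
  conj_rev (N + M) (p * q) = conj_rev N p * conj_rev M q.
Proof.
move=> hp hq; apply: poly_eq_circle => z z1.
have hpq : (size (p * q)%R <= (N + M).+1)%N.
  by apply: leq_trans (size_polyMleq _ _) _; lia.
by rewrite hornerM !conj_rev_circle // hornerM rmorphM exprD /= mulrACA.
Qed.

Lemma conj_revK N p : (size p <= N.+1)%N -> conj_rev N (conj_rev N p) = p.
Proof.
move=> hp; apply: poly_eq_circle => z z1.
rewrite !conj_rev_circle ?size_conj_rev // rmorphM rmorphXn /= conjCK mulrA.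
by rewrite -exprMn circle_mulJ // expr1n mul1r.
Qed.

Lemma conj_revB N p q :
  conj_rev N (p - q) = conj_rev N p - conj_rev N q.
Proof.
by apply/polyP => i; rewrite coefB !coef_poly;
  case: ifP; rewrite ?subr0 // coefB rmorphB.
Qed.

Lemma conj_revZ N a p : conj_rev N (a *: p) = a^* *: conj_rev N p.
Proof.
by apply/polyP => i; rewrite coefZ !coef_poly;
  case: ifP; rewrite ?mulr0 // coefZ rmorphM.
Qed.

Lemma size_prod_ord_XsubC n (a : 'I_n -> K) :
  size (\prod_i ('X - (a i)%:P)) = n.+1.
Proof. by rewrite size_prod_XsubC [index_enum _]unlock -enumT size_enum_ord. Qed.

Lemma conj_rev_prodXsubC n (a : 'I_n -> K) :
  conj_rev n (\prod_i ('X - (a i)%:P)) = \prod_i (1 - (a i)^* *: 'X).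
Proof.
apply: poly_eq_circle => z z1.
rewrite conj_rev_circle ?size_prod_ord_XsubC //.
rewrite !horner_prod rmorph_prod /= -[X in z ^+ X]card_ord -prodr_const.
rewrite -big_split /=; apply: eq_bigr => i _.
by rewrite !hornerE rmorphB /= mulrBr circle_mulJ // mulrC.
Qed.

Lemma size_conj_rev_eq N p : p.[0] != 0 -> size (conj_rev N p) = N.+1.
Proof.
move=> p0; apply/eqP; rewrite eqn_leq size_conj_rev /= ltnNge; apply/negP => h.
have : (conj_rev N p)`_N = 0 by rewrite nth_default.
rewrite coef_poly ltnSn subnn => /eqP; rewrite fmorph_eq0.
by rewrite -horner_coef0; apply/negP.
Qed.

Lemma conj_rev_eq0 N p : (size p <= N.+1)%N -> (conj_rev N p == 0) = (p == 0).
Proof.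
have r0 : conj_rev N 0 = 0.
  by apply/polyP => i; rewrite coef_poly !coef0 rmorph0 if_same.
move=> hp; apply/eqP/eqP => [h|->//].
by rewrite -(conj_revK hp) h.
Qed.

Lemma conj_rev_root_disc N p z : (size p <= N.+1)%N ->
  (forall w, `|w| <= 1 -> p.[w] != 0) -> (conj_rev N p).[z] = 0 -> `|z| < 1.
Proof.
move=> hp pd; have [->|z0] := eqVneq z 0; first by rewrite normr0 ltr01.
rewrite horner_conj_rev // => /eqP; rewrite mulf_eq0 expf_eq0 (negbTE z0) andbF /=.
rewrite fmorph_eq0 => h; rewrite real_ltNge ?normr_real ?real1 //; apply/negP => z1.
suff : `|(z^*)^-1| <= 1 by move/pd; rewrite h.
by rewrite normfV norm_conjC invf_le1 // normr_gt0.
Qed.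

(** * Rational functions unimodular on the circle *)

Lemma horner0_neq0 p : (forall w, `|w| <= 1 -> p.[w] != 0) -> p.[0] != 0.
Proof. by apply; rewrite normr0 ler01. Qed.

Lemma coprimep_common p q z : coprimep p q -> p.[z] = 0 -> q.[z] != 0.
Proof.
move=> c h; apply/negP => /eqP hq.
by have := coprimep_root c; move/(_ z); rewrite /root h eqxx hq eqxx => /(_ isT).
Qed.

Lemma coprimep_noroot p q :
  (forall z, p.[z] = 0 -> q.[z] != 0) -> coprimep p q.
Proof.
move=> h; have [//|nc] := boolP (coprimep p q).
have /closed_rootP[z] : size (gcdp p q) != 1%N by [].
by rewrite root_gcd => /andP[/rootP/h hp /rootP hq]; rewrite hq eqxx in hp.
Qed.

(** On the circle [|p| = |q|] reads p p~ = q q~. Coprimality gives q~ = u p, hence p~ = q u; as [p]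
    or [q] attains the formal degree [N], the cofactor u is constant. *)
Lemma unimodular_ratio p q : coprimep p q ->
  (forall z, `|z| = 1 -> q.[z] != 0) ->
  (forall z, `|z| = 1 -> `|p.[z]| = `|q.[z]|) ->
  exists N c, [/\ `|c| = 1, (size q <= N.+1)%N & p = c *: conj_rev N q].
Proof.
move=> cpq qd pq.
have p0 : p != 0.
  apply/eqP => p0; have := pq 1 (normr1 _); rewrite p0 horner0 normr0 => /esym/eqP.
  by rewrite normr_eq0; apply/negP/qd/normr1.
have q0 : q != 0.
  by apply/eqP => q0; have := qd 1 (normr1 _); rewrite q0 horner0 eqxx.
pose N := (maxn (size p) (size q)).-1.
have hp : (size p <= N.+1)%N by have := size_poly_gt0 p; rewrite p0 /N; lia.
have hq : (size q <= N.+1)%N by rewrite /N; lia.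
have E : p * conj_rev N p = q * conj_rev N q.
  apply: poly_eq_circle => z z1.
  rewrite !hornerM !conj_rev_circle // !(mulrCA _ (z ^+ N)) -!normCK.
  by rewrite pq.
have : p %| conj_rev N q by rewrite -(Gauss_dvdpr _ cpq) -E dvdp_mulr.
move=> /dvdpP[u hu].
have hu2 : conj_rev N p = q * u.
  by apply: (mulfI p0); rewrite E hu; ring.
have u0 : u != 0.
  by apply/eqP => u0; move/eqP: hu; rewrite u0 mul0r conj_rev_eq0 // (negbTE q0).
have su : size u = 1%N.
  have := size_conj_rev N q; have := size_conj_rev N p.
  rewrite hu hu2 !size_mul // ; have := size_poly_gt0 u; rewrite u0.
  have := size_poly_gt0 q; rewrite q0; move: p0; rewrite -size_poly_gt0 /N;
  move: (size p) (size q) (size u) => *; lia.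
have /size_poly1P[d d0 ud] : size u == 1%N by rewrite su.
(* The constant [d] is unimodular because q~ = d p and q~, p have the same nonzero modulus at the
   point 1. *)
exists N, d^-1; split=> //.
- have pq1 := pq 1 (normr1 _); have := conj_rev_circle hq (normr1 K).
  rewrite expr1n mul1r hu ud hornerM hornerC => /(congr1 Num.norm).
  rewrite norm_conjC normrM -pq1 -[RHS]mul1r => e.
  have p10 : `|p.[1]| != 0 by rewrite pq1 normr_eq0 qd ?normr1.
  by rewrite normfV (mulIf p10 e) invr1.
- by rewrite hu ud mul_polyC scalerA mulVf // scale1r.
Qed.

(** With xi = pi / qi for i = 1, 2 and x3 = D~ / D, the relation x2 = conj(x1) x3 on the circle
    becomes p2 q1~ D = q2 p1~ D~. Here [q2] is coprime to [p2], and also to q1~, whose zeros lie in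
    the open disc where [q2] has none; so [q2] divides [D]. *)
Lemma common_denominator n p1 q1 p2 q2 D : coprimep p2 q2 ->
  (forall z, `|z| <= 1 -> q1.[z] != 0) -> (forall z, `|z| <= 1 -> q2.[z] != 0) ->
  (forall z, `|z| <= 1 -> D.[z] != 0) -> (size D <= n.+1)%N ->
  (forall z, `|z| = 1 ->
    p2.[z] / q2.[z] = (p1.[z] / q1.[z])^* * ((conj_rev n D).[z] / D.[z])) ->
  exists2 E : {poly K}, (size E <= n.+1)%N & E * q2 = D * p2.
Proof.
move=> c2 q1d q2d Dd hD H.
have D0 : D != 0 by apply/eqP => D0; have := horner0_neq0 Dd; rewrite D0 horner0 eqxx.
have q20 : q2 != 0 by apply/eqP => e; have := horner0_neq0 q2d; rewrite e horner0 eqxx.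
pose M := maxn (size p1) (size q1).
have hp1 : (size p1 <= M.+1)%N by rewrite /M; lia.
have hq1 : (size q1 <= M.+1)%N by rewrite /M; lia.
have E : p2 * (conj_rev M q1 * D) = q2 * (conj_rev M p1 * conj_rev n D).
  apply: poly_eq_circle => z z1; rewrite !hornerM !conj_rev_circle //.
  have := H z z1; rewrite conj_rev_circle // rmorphM fmorphV /= => e.
  have d1 : q2.[z] != 0 by apply: q2d; rewrite z1.
  have d2 : (q1.[z])^* != 0 by rewrite fmorph_eq0; apply: q1d; rewrite z1.
  have d3 : D.[z] != 0 by apply: Dd; rewrite z1.
  have -> : p2.[z] = q2.[z] * (p2.[z] / q2.[z]) by rewrite mulrCA divff // mulr1.
  by rewrite e; field; rewrite d2 d3.
have cq : coprimep q2 (conj_rev M q1).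
  apply: coprimep_noroot => z hz; apply/eqP => /(conj_rev_root_disc hq1 q1d) /ltW.
  by move/q2d; rewrite hz eqxx.
have : q2 %| D.
  rewrite coprimep_sym in c2.
  by rewrite -(Gauss_dvdpr _ cq) -(Gauss_dvdpr _ c2) E dvdp_mulr.
move=> /dvdpP[v hv]; exists (v * p2); last by rewrite hv; ring.
have [->|p20] := eqVneq p2 0; first by rewrite mulr0 size_poly0.
have v0 : v != 0 by apply: contraNneq D0 => v0; rewrite hv v0 mul0r.
have E2 : v * p2 * conj_rev M q1 = conj_rev M p1 * conj_rev n D.
  by apply: (mulfI q20); rewrite -E hv; ring.
(* Since [q1] does not vanish at 0, q1~ has degree exactly [M], while p1~ and D~ have degree at most
   [M] and [n]: this bounds the degree of [v * p2] by [n]. *)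
have sr : size (conj_rev M q1) = M.+1 by rewrite size_conj_rev_eq ?(horner0_neq0 q1d).
have := size_polyMleq (conj_rev M p1) (conj_rev n D).
rewrite -E2 size_mul ?mulf_neq0 ?sr //; last by rewrite -size_poly_gt0 sr.
have := size_conj_rev M p1; have := size_conj_rev n D.
move: (size (conj_rev n D)) (size (conj_rev M p1)) (size (v * p2)%R) => a b c; lia.
Qed.

(** The points [a i] are the reflections of the zeros of [q]. The quotient q~ / q is thereby a
    unimodular constant times a Blaschke product of exactly [N] factors. *)
Lemma blaschke_factorization N q : (size q <= N.+1)%N ->
  (forall z, `|z| <= 1 -> q.[z] != 0) ->
  exists a : 'I_N -> K, [/\ forall i, `|a i| < 1,
    q = q.[0] *: \prod_i (1 - (a i)^* *: 'X)
    & conj_rev N q = (q.[0])^* *: \prod_i ('X - (a i)%:P)].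
Proof.
move=> hq qd; have q00 := horner0_neq0 qd.
have q0 : q != 0 by apply: contraNneq q00 => ->; rewrite horner0.
have [rs qE] := closed_field_poly_normal q.
have lq : lead_coef q != 0 by rewrite lead_coef_eq0.
have srs : (size rs <= N)%N.
  by move: hq; rewrite qE size_scale // size_prod_XsubC.
have rs1 i : (i < size rs)%N -> 1 < `|rs`_i|.
  move=> hi; rewrite real_ltNge ?normr_real ?real1 //; apply/negP => /qd.
  rewrite qE hornerZ mulf_eq0 (negbTE lq) /= => /negP; apply.
  by rewrite -[_ == 0]/(root _ _) root_prod_XsubC mem_nth.
(* Beyond the last root the default value 0 and the convention that 0 has inverse 0 give [a i = 0]:
   a factor 1 in [q] and a factor ['X] in its reflection. *)
pose a (i : 'I_N) : K := ((rs`_i)^*)^-1.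
have ad i : `|a i| < 1.
  have [hi|hi] := ltnP i (size rs); last first.
    by rewrite /a nth_default // rmorph0 invr0 normr0 ltr01.
  rewrite normfV norm_conjC invf_lt1 ?rs1 //.
  by apply: lt_trans (rs1 _ hi); rewrite ltr01.
have e : q = q.[0] *: \prod_i (1 - (a i)^* *: 'X).
  have -> : \prod_i (1 - (a i)^* *: 'X) = \prod_(i < size rs) (1 - (rs`_i)^-1 *: 'X).
    under eq_bigr => i _ do rewrite /a fmorphV /= conjCK.
    rewrite (big_ord_widen N (fun i => 1 - (rs`_i)^-1 *: 'X) srs)
      [LHS](bigID (fun i : 'I_N => i < size rs)%N) /=.
    rewrite [X in _ * X]big1 ?mulr1 // => i; rewrite -leqNgt => hi.
    by rewrite nth_default // invr0 scale0r subr0.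
  have -> : \prod_(i < size rs) (1 - (rs`_i)^-1 *: 'X) =
     (\prod_(r <- rs) (- r)^-1) *: \prod_(r <- rs) ('X - r%:P).
    rewrite (big_nth 0) big_mkord [in RHS](big_nth 0) big_mkord.
    rewrite -scaler_prod; apply: eq_bigr => i _.
    have ri : rs`_i != 0 by rewrite -normr_gt0; apply: lt_trans (rs1 i _).
    rewrite scalerBr -!mul_polyC invrN -polyCM mulNr mulVf // !polyCN.
    by rewrite polyC1; ring.
  rewrite {1 2}qE hornerZ horner_prod scalerA; congr (_ *: _).
  under [X in _ * X * _]eq_bigr => i _ do rewrite hornerXsubC sub0r.
  rewrite -mulrA -big_split /= big_seq big1 ?mulr1 // => r rrs.
  rewrite divff // oppr_eq0 -normr_gt0.
  by have := rs1 (index r rs); rewrite index_mem nth_index // => /(_ rrs); apply: lt_trans.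
exists a; split=> //.
by rewrite {1}e -conj_rev_prodXsubC conj_revZ conj_revK // size_prod_ord_XsubC.
Qed.


(** * Polynomials determined by the nodes *)

Lemma deriv_root_XsubC_mul a q : (('X - a%:P) * q)^`().[a] = q.[a].
Proof. by rewrite derivM derivXsubC mul1r !hornerE subrr mul0r addr0. Qed.

Lemma dvd_prod_ord_XsubC n (s : 'I_n -> K) p : injective s ->
  (forall j, p.[s j] = 0) -> exists q, p = q * \prod_j ('X - (s j)%:P).
Proof.
move=> si ps; apply/dvdpP.
have -> : \prod_j ('X - (s j)%:P) = \prod_(r <- [seq s j | j : 'I_n]) ('X - r%:P).
  by rewrite big_image.
apply: uniq_roots_dvdp; last by rewrite uniq_rootsE map_inj_uniq ?enum_uniq.
by apply/allP => _ /fintype.imageP[j _ ->]; apply/rootP.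
Qed.

(** A vanishing factor means [(s j)^* * z = 1]. With both moduli at most 1 this forces [|s j| = 1]
    and then [s j = z], which is excluded. *)
Lemma prod_one_subZX_neq0 n (s : 'I_n -> K) z : `|z| <= 1 ->
  (forall j, `|s j| < 1 \/ `|s j| = 1 /\ s j != z) ->
  (\prod_j (1 - (s j)^* *: 'X)).[z] != 0.
Proof.
move=> z1 hs; rewrite horner_prod; apply/prodf_neq0 => j _.
rewrite !hornerE subr_eq0; apply/eqP => e.
have := congr1 Num.norm e; rewrite normr1 normrM norm_conjC.
have [lt1|[eq1 ne] _] := hs j.
  move=> e1; suff : 1 < 1 :> K by rewrite ltxx.
  by rewrite {1}e1 (le_lt_trans _ lt1) // ler_piMr.
move: ne; rewrite -[z]mul1r -{1}(circle_mulJ eq1) -mulrA -e mulr1.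
by rewrite eqxx.
Qed.

(* At a node of the open disc, a zero of [conj_rev (n + n) Q] stands for a zero
   of [Q] at the reflected point, which lies at infinity if the node is 0. *)
Lemma full_node_polynomial n (s : 'I_n -> K) (Q : {poly K}) : injective s ->
  (size Q <= (n + n).+1)%N -> (forall j, Q.[s j] = 0) ->
  (forall j, `|s j| < 1 /\ (conj_rev (n + n) Q).[s j] = 0 \/
             `|s j| = 1 /\ Q^`().[s j] = 0) ->
  exists c, Q = c *: (\prod_j ('X - (s j)%:P) * \prod_j (1 - (s j)^* *: 'X)).
Proof.
move=> si hQ Qs Qs2; set M := \prod_j ('X - _).
have sM : size M = n.+1 := size_prod_ord_XsubC s.
have M0 : M != 0 by rewrite -size_poly_gt0 sM.
have [Q1 QE] := dvd_prod_ord_XsubC si Qs; rewrite -/M in QE.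
have [->|Q0] := eqVneq Q 0; first by exists 0; rewrite scale0r.
have Q10 : Q1 != 0 by apply: contraNneq Q0 => e; rewrite QE e mul0r.
have sQ1 : (size Q1 <= n.+1)%N.
  by move: hQ; rewrite QE size_mul // sM; move: (size (Q1 : {poly K})) => m; lia.
(* In the disc, the reflection of [Q] is that of [Q1] times a factor which is nonzero at [s j]. On
   the circle, the derivative of [Q] at [s j] is [Q1.[s j]] times the product of the differences of
   the nodes. So a second copy of [M] splits off, now from the reflection of [Q1], and only a
   constant is left by degree. *)
have Q1s j : (conj_rev n Q1).[s j] = 0.
  have [[s1]|[s1]] := Qs2 j.
    rewrite QE conj_revM // ?sM // conj_rev_prodXsubC hornerM => /eqP; rewrite mulf_eq0.
    rewrite (negbTE (prod_one_subZX_neq0 (ltW s1) _)) ?orbF; first by move=> /eqP.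
    move=> i; have [[]|[si1 _]] := Qs2 i; [by left | right; split=> //].
    by apply: contraTneq s1 => <-; rewrite si1 ltxx.
  rewrite QE /M (bigD1 j) //=; rewrite mulrCA deriv_root_XsubC_mul hornerM => /eqP.
  rewrite mulf_eq0 => /orP[/eqP e|]; first by rewrite conj_rev_circle // e rmorph0 mulr0.
  apply: contraTeq => _; rewrite horner_prod; apply/prodf_neq0 => i ij.
  by rewrite hornerXsubC subr_eq0 eq_sym (inj_eq si).
have [Q2 Q2E] := dvd_prod_ord_XsubC si Q1s; rewrite -/M in Q2E.
have Q20 : Q2 != 0.
  by apply: contraNneq Q10 => e; rewrite -(conj_rev_eq0 sQ1) Q2E e mul0r.
have /size_poly1P[c c0 cE] : size Q2 == 1%N.
  have := size_conj_rev n Q1; rewrite Q2E size_mul // sM.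
  by move: Q20; rewrite -size_poly_gt0; move: (size (Q2 : {poly K})) => m; lia.
exists c^*; rewrite QE -(conj_revK sQ1) Q2E cE mul_polyC conj_revZ.
by rewrite conj_rev_prodXsubC -scalerAl mulrC.
Qed.

End Reversal.

(** * Complex numbers over a realType *)

(* Without this, no filter structure is found on the neighborhoods of a point of
   [C R], and the limit lemmas do not apply. *)
#[local] Instance nbhs_C_filter (R : realType) (z : C R) : ProperFilter (nbhs z).
Proof. exact: nbhs_pfilter. Qed.

Section ComplexBasics.
Variable R : realType.
Implicit Types (z w : C R) (a b r : R).

Lemma cisD a b : cis (a + b) = cis a * cis b.
Proof.
rewrite /cis cosD sinD; apply/eqP; rewrite eq_complex /=.
by apply/andP; split; apply/eqP; ring.
Qed.

Lemma cisN a : cis (- a) = (cis a)^*.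
Proof. by rewrite /cis cosN sinN. Qed.

Lemma norm_cis a : `|cis a| = 1.
Proof. by rewrite normc_def /= cos2Dsin2 sqrtr1. Qed.

Lemma rcD a b : rc (a + b) = rc a + rc b. Proof. exact: (rmorphD (real_complex R)). Qed.
Lemma rcM a b : rc (a * b) = rc a * rc b. Proof. exact: (rmorphM (real_complex R)). Qed.
Lemma rcV a : (rc a)^-1 = rc a^-1.
Proof. by rewrite -[RHS]/(real_complex R _) fmorphV. Qed.
Lemma rc_le a b : (rc a <= rc b) = (a <= b). Proof. exact: lecR. Qed.
Lemma rc_lt a b : (rc a < rc b) = (a < b). Proof. exact: ltcR. Qed.

(** Positive elements of [C R] are real in its partial order, so the radii that occur in limits over
    [C R] can be replaced by real numbers. *)
Lemma gt0_rc (e : C R) : 0 < e -> exists2 r, 0 < r & e = rc r.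
Proof. by case: e => a b; rewrite ltcE /= => /andP[/eqP -> a0]; exists a. Qed.

Lemma norm_Complex_le a b : `|Complex a b : C R| <= rc (`|a| + `|b|).
Proof.
rewrite normc_def /= rc_le -[leRHS]ger0_norm ?addr_ge0 // -sqrtr_sqr ler_wsqrtr //.
rewrite sqrrD !real_normK ?num_real // lerD2r lerDl mulrn_wge0 // mulr_ge0 //.
Qed.

Lemma cvg_Complex (T : Type) (F : set_system T) (FF : Filter F) (u v : T -> R) a b :
  u @ F --> a -> v @ F --> b ->
  (fun t => Complex (u t) (v t) : C R) @ F --> (Complex a b : C R).
Proof.
move=> /cvgrPdist_lt ua /cvgrPdist_lt vb; apply/cvgrPdist_lt => e /gt0_rc[r r0 ->].
have r2 : 0 < r / 2 by rewrite divr_gt0.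
near=> t; apply: le_lt_trans (norm_Complex_le _ _) _.
rewrite rc_lt [ltRHS]splitr ltrD //; [near: t; exact: ua|near: t; exact: vb].
Unshelve. all: by end_near. Qed.

Lemma continuous_cis : continuous (@cis R).
Proof. by move=> t; apply: cvg_Complex; [exact: continuous_cos|exact: continuous_sin]. Qed.

Lemma continuous_Re : continuous (@complex.Re R : C R -> R).
Proof.
move=> z; apply/(@cvgrPdist_lt _ _ _ (nbhs z) (nbhs_filter z)) => e e0.
have e1 : (0 : C R) < rc e by rewrite (rc_lt 0).
have zz : \forall w \near z, `|z - w| < rc e by apply/nbhs_ballP; exists (rc e).
near=> w; rewrite -rc_lt; apply: (@le_lt_trans _ _ `|z - w|).
  rewrite (_ : _ - _ = complex.Re (z - w)); first exact: normc_ge_Re.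
  by case: (z) (w) => [? ?] [? ?].
by near: w.
Unshelve. all: by end_near.
Qed.

Lemma continuous_horner_C (p : {poly C R}) : continuous (horner p).
Proof.
elim/poly_ind: p => [|p c IH] z.
  rewrite (_ : horner 0 = fun=> 0 : C R); first exact: cvg_cst.
  by apply/funext => w; rewrite horner0.
rewrite (_ : horner _ = fun w => p.[w] * w + c); last first.
  by apply/funext => w; rewrite hornerMXaddC.
apply: cvgD; last exact: cvg_cst.
apply: cvgM; [exact: IH|exact: cvg_id].
Qed.

End ComplexBasics.

(** * Angles, the argument on the right half plane, limits within a set *)

Section Circle.
Variable R : realType.
Implicit Types (z w : C R) (a b r : R).

Lemma circle_cis z : `|z| = 1 -> exists2 t : R, 0 <= t <= 2 * pi & z = cis t.
Proof.
case: z => a b; rewrite normc_def /= => -[] h.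
have ab : a ^+ 2 + b ^+ 2 = 1.
  by rewrite -[LHS]sqr_sqrtr ?addr_ge0 ?sqr_ge0 // h expr1n.
have a1 : -1 <= a <= 1.
  by rewrite -ler_norml -ler_sqr ?nnegrE // real_normK ?num_real //
    expr1n -ab lerDl sqr_ge0.
have pi0 := pi_ge0 R; have t0 := acos_ge0 a1; have tpi := acos_lepi a1.
have ca : cos (acos a) = a by rewrite acosK // in_itv.
have sa : sin (acos a) = `|b|.
  by rewrite sin_acos // -ab addrAC subrr add0r sqrtr_sqr.
have [b0|b0] := lerP 0 b.
  exists (acos a); first by rewrite t0 /=; lra.
  by rewrite /cis ca sa ger0_norm.
exists (- acos a + pi *+ 2); first by rewrite mulr2n; lra.
by rewrite /cis cosD2pi sinD2pi cosN sinN ca sa ltr0_norm // opprK.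
Qed.

(** An explicit continuous branch of the argument on the right half plane; the argument functions
    constructed below are built from it. *)
Lemma cis_arg w : 0 < complex.Re w ->
  w = `|w| * cis (atan (complex.Im w / complex.Re w)).
Proof.
case: w => a b /= a0; set u := b / a.
have s0 : 0 < Num.sqrt (1 + u ^+ 2).
  by rewrite sqrtr_gt0 ltr_pwDl // sqr_ge0.
have e : Num.sqrt (a ^+ 2 + b ^+ 2) = a * Num.sqrt (1 + u ^+ 2).
  rewrite -[a in RHS]ger0_norm ?ltW // -sqrtr_sqr -sqrtrM ?sqr_ge0 //.
  by congr Num.sqrt; rewrite /u; field; rewrite gt_eqF.
have cu : cos (atan u) = (Num.sqrt (1 + u ^+ 2))^-1 by exact: cos_atan.
have su : sin (atan u) = u * (Num.sqrt (1 + u ^+ 2))^-1.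
  by rewrite -cu -{2}[u]atanK /tan divfK // cu invr_eq0 gt_eqF.
rewrite normc_def /= e /cis cu su; apply/eqP; rewrite eq_complex /= !mul0r subr0 addr0.
by rewrite /u; apply/andP; split; apply/eqP; field; rewrite ?gt_eqF.
Qed.

Lemma within_cvg (S T : topologicalType) (A : set S) (f : S -> T) (I : Type)
  (F : set_system I) (FF : Filter F) (g : I -> S) (s : S) :
  {within A, continuous f} -> A s -> g @ F --> s -> (\forall i \near F, A (g i)) ->
  (f \o g) @ F --> f s.
Proof.
move=> /subspace_continuousP fc As gs Ag.
apply: cvg_trans (fc s As) => P /= fP.
have : \forall i \near F, (A (g i) -> P (f (g i))) by exact: (gs _ fP).
by apply: filterS2 Ag => i Ai; exact.
Qed.

End Circle.

(** * Rational functions on the disc *)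

Section Radial.
Variable R : realType.
Implicit Types (z w u v : C R) (p q : {poly C R}).

Lemma cvg_ray z u : (z + rc s * u) @[s --> (0 : R)^'+] --> z.
Proof.
rewrite -[X in _ --> X]addr0 -[X in _ + X](mul0r u).
apply: cvgD; first exact: cvg_cst.
apply: cvgM; last exact: cvg_cst.
apply: cvg_Complex; last exact: cvg_cst.
exact: cvg_at_right_filter cvg_id.
Qed.

Lemma cvg_horner (T : Type) (F : set_system T) (FF : Filter F) (c : T -> C R) z p :
  c @ F --> z -> p.[c t] @[t --> F] --> p.[z].
Proof. by move=> cz; apply: continuous_cvg cz; exact: continuous_horner_C. Qed.

(** Zeros are isolated: once the power of ['X - z%:P] is split off, the remaining factor is nonzero
    at [z], hence nearby. *)
Lemma near_ray_horner_neq0 p z u : p != 0 -> u != 0 ->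
  \forall s \near (0 : R)^'+, p.[z + rc s * u] != 0.
Proof.
move=> p0 u0; have [m [q]] := multiplicity_XsubC p z.
rewrite p0 /= => qz ->.
have qc : q.[z + rc s * u] @[s --> (0 : R)^'+] --> q.[z].
  by apply: cvg_horner; exact: cvg_ray.
have qn : \forall s \near (0 : R)^'+, q.[z + rc s * u] != 0.
  by apply: (cvgr_neq0 q.[z] qc).
near=> s; rewrite hornerM horner_exp hornerXsubC addrAC subrr add0r.
rewrite mulf_neq0 //; first by near: s.
rewrite expf_neq0 // mulf_neq0 // -[0]/(rc 0); apply/eqP => -[s0].
suff : 0 < s by rewrite s0 ltxx.
by near: s; exact: nbhs_right_gt.
Unshelve. all: by end_near. Qed.

(** After reduction to lowest terms, f q = p holds on the whole closed disc by passage to the limit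
    along a segment that enters the open disc. A zero of q there would then be a zero of p, against
    coprimality. *)
Lemma rational_closed_disc (f : C R -> C R) :
  rational_on disc f -> {within closed_disc, continuous f} ->
  exists p q, [/\ coprimep p q, forall z, `|z| <= 1 -> q.[z] != 0
    & forall z, `|z| <= 1 -> f z = p.[z] / q.[z]].
Proof.
move=> [p0 [q0 [q00 fE]]] fc.
pose g := gcdp p0 q0; pose p := p0 %/ g; pose q := q0 %/ g.
have pE : p0 = p * g by rewrite divpK // dvdp_gcdl.
have qE : q0 = q * g by rewrite divpK // dvdp_gcdr.
have cpq : coprimep p q by rewrite coprimep_div_gcd // q00 orbT.
have E z : `|z| <= 1 -> f z * q.[z] = p.[z].
  move=> z1; pose v : C R := if z == 0 then 2^-1 else 0.
  have v1 : `|v| < 1.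
    by rewrite /v; case: ifP; rewrite ?normr0 // normfV normr_nat invf_lt1 // ltr1n.
  have u0 : v - z != 0.
    rewrite /v; case: (eqVneq z 0) => [->|z0]; first by rewrite subr0 invr_eq0 pnatr_eq0.
    by rewrite sub0r oppr_eq0.
  pose c s := z + rc s * (v - z).
  have cc : c s @[s --> (0 : R)^'+] --> z by exact: cvg_ray.
  have cd : \forall s \near (0 : R)^'+, disc (c s).
    near=> s; have s0 : 0 < s by near: s; exact: nbhs_right_gt.
    have s1 : s < 1 by near: s; exact: nbhs_right_lt.
    rewrite /disc /= /c (_ : _ + _ = rc (1 - s) * z + rc s * v); last first.
      by rewrite (_ : rc (1 - s) = 1 - rc s); [ring|
        rewrite /rc; apply/eqP; rewrite eq_complex /= subr0 !eqxx].
    have h1 : `|rc (1 - s)| = rc (1 - s) by rewrite ger0_norm // (rc_le 0); lra.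
    have h2 : `|rc s| = rc s by rewrite ger0_norm // (rc_le 0); lra.
    apply: le_lt_trans (ler_normD _ _) _; rewrite !normrM h1 h2.
    have : rc (1 - s) * `|z| + rc s * `|v| < rc (1 - s) * 1 + rc s * 1.
      by rewrite ler_ltD ?ler_pM2l ?ltr_pM2l ?(rc_lt 0) //; lra.
    by rewrite !mulr1 -rcD subrK.
  have L : (f (c s) * q.[c s] - p.[c s]) @[s --> (0 : R)^'+] --> f z * q.[z] - p.[z].
    apply: cvgB; last exact: cvg_horner cc.
    apply: cvgM; last exact: cvg_horner cc.
    have := @within_cvg _ _ _ _ _ _ _ c _ fc z1 cc; apply.
    by apply: filterS cd => s; exact: ltW.
  have L0 : (f (c s) * q.[c s] - p.[c s]) @[s --> (0 : R)^'+] --> (0 : C R).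
    apply: cvg_near_cst; near=> s.
    have q0s : q0.[c s] != 0 by near: s; exact: near_ray_horner_neq0.
    have ds : disc (c s) by near: s.
    rewrite fE // pE qE !hornerM.
    move: q0s; rewrite qE hornerM mulf_eq0 negb_or => /andP[qs gs].
    by field; rewrite qs gs.
  apply/eqP; rewrite -subr_eq0; apply/eqP; apply: (cvg_unique _ L L0).
  exact: norm_hausdorff.
have qn z : `|z| <= 1 -> q.[z] != 0.
  move=> z1; apply/eqP => qz; have := E z z1; rewrite qz mulr0 => /esym pz.
  by have := coprimep_common cpq pz; rewrite qz eqxx.
exists p, q; split=> // z z1; rewrite -E // mulfK // qn //.
Unshelve. all: by end_near. Qed.

(** If p and q differ, p - q = (X - z)^m k with k(z) nonzero. In a direction u with u^m = q(z) /
    k(z), p is close to (1 + s^m) q at z + s u, so that |p| exceeds |q| for small s > 0. *)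
Lemma polynomial_maximum_modulus p q (z : C R) : `|z| < 1 ->
  (forall w, `|w| < 1 -> `|p.[w]| <= `|q.[w]|) -> q.[z] != 0 -> p.[z] = q.[z] ->
  p = q.
Proof.
move=> z1 pq qz pqz; apply/eqP; rewrite -subr_eq0; apply: contraT => d0.
have [m [k]] := multiplicity_XsubC (p - q) z; rewrite d0 /= => kz E.
have kz0 : k.[z] != 0 by [].
have m0 : (0 < m)%N.
  rewrite lt0n; apply/eqP => m0; move: (congr1 (horner^~ z) E) kz0.
  by rewrite m0 expr0 mulr1 !hornerE pqz subrr => <-; rewrite eqxx.
have qk0 : q.[z] / k.[z] != 0 by rewrite mulf_neq0 ?invr_eq0.
pose u := m.-root (q.[z] / k.[z]).
have um : u ^+ m = q.[z] / k.[z] by rewrite rootCK.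
have hq : q.[z + rc s * u] @[s --> (0 : R)^'+] --> q.[z].
  by apply: cvg_horner; exact: cvg_ray.
have hk : (u ^+ m * k.[z + rc s * u]) @[s --> (0 : R)^'+] --> q.[z].
  rewrite -[X in _ --> X](divfK kz0) -um.
  apply: cvgM; first exact: cvg_cst.
  by apply: cvg_horner; exact: cvg_ray.
have q2 : 0 < `|q.[z]| / 4 by rewrite divr_gt0 // normr_gt0.
have hz : \forall s \near (0 : R)^'+, `|z + rc s * u| < 1.
  have e0 : 0 < 1 - `|z| by rewrite subr_gt0.
  near=> s; have : `|z - (z + rc s * u)| < 1 - `|z|.
    by near: s; apply: cvgr_dist_lt e0; exact: cvg_ray.
  rewrite ltrBrDl; apply: le_lt_trans.
  by rewrite distrC -{1}[z + _](subrK z) addrC ler_normD.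
suff : \forall s \near (0 : R)^'+, False by move=> /filter_ex[].
near=> s.
have s0 : 0 < s by near: s; exact: nbhs_right_gt.
have sm : 0 < rc s ^+ m by rewrite exprn_gt0 // (rc_lt 0).
(* A quarter suffices: the error [u ^+ m * K - Q] is then below one half of [|q.[z]|], and [|Q|]
   above three quarters of it. *)
have e1 : `|q.[z] - q.[z + rc s * u]| < `|q.[z]| / 4.
  by near: s; apply: cvgr_dist_lt q2; exact: hq.
have e2 : `|q.[z] - u ^+ m * k.[z + rc s * u]| < `|q.[z]| / 4.
  by near: s; apply: cvgr_dist_lt q2; exact: hk.
have z2 : `|z + rc s * u| < 1 by near: s.
have := pq _ z2; rewrite -[p](subrK q) E !hornerE addrAC subrr add0r.
move: e1 e2; set K := k.[_]; set Q := q.[z + _] => e1 e2.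
rewrite real_leNgt ?normr_real // => /negP; apply.

rewrite exprMn (_ : K * _ + Q =
  rc s ^+ m * (u ^+ m * K - Q) + (1 + rc s ^+ m) * Q); last by ring.
have e3 : `|u ^+ m * K - Q| < `|Q|.
  have : `|u ^+ m * K - Q| <= `|q.[z] - Q| + `|q.[z] - u ^+ m * K|.
    rewrite -[u ^+ m * K - Q](_ : (q.[z] - Q) - (q.[z] - u ^+ m * K) = _); last by ring.
    exact: ler_normB.
  have : `|q.[z]| <= `|q.[z] - Q| + `|Q|.
    by rewrite -{1}[q.[z]](subrK Q) ler_normD.
  move=> h1 h2; have h3 : `|u ^+ m * K - Q| < `|q.[z]| / 4 + `|q.[z]| / 4.
    by apply: le_lt_trans h2 _; rewrite ltrD.
  have h4 : `|q.[z]| - `|q.[z]| / 4 < `|Q|.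
    by rewrite ltrBlDl; apply: le_lt_trans h1 _; rewrite ltrD2r.
  apply: lt_trans h4; apply: lt_le_trans h3 _.
  rewrite -subr_ge0 (_ : _ - _ = `|q.[z]| / 4); last by field.
  exact: ltW.
have : `|(1 + rc s ^+ m) * Q| <=
  `|rc s ^+ m * (u ^+ m * K - Q) + (1 + rc s ^+ m) * Q| + `|rc s ^+ m * (u ^+ m * K - Q)|.
  rewrite -{1}[X in `|X|](addKr (rc s ^+ m * (u ^+ m * K - Q))) addrC.
  exact: ler_normB.
rewrite !normrM (gtr0_norm sm) (gtr0_norm (addr_gt0 ltr01 sm)).
rewrite mulrDl mul1r => h.
rewrite -(ltrD2r (rc s ^+ m * `|u ^+ m * K - Q|)).
by apply: lt_le_trans h; rewrite ltrD2l ltr_pM2l.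
Unshelve. all: by end_near. Qed.

End Radial.

(** * The distinguished boundary *)

Section Boundary.
Variable R : realType.
Implicit Types (z w u v : C R) (p q : {poly C R}).

Lemma continuous_fst (S T : topologicalType) : continuous (@fst S T).
Proof. by move=> [s t]; exact: cvg_fst. Qed.

Lemma continuous_snd (S T : topologicalType) : continuous (@snd S T).
Proof. by move=> [s t]; exact: cvg_snd. Qed.

Lemma continuous_conj : continuous (fun z : C R => z^*).
Proof.
move=> z; apply/cvgrPdist_lt => e e0; near=> w.
rewrite -rmorphB norm_conjC; near: w.
by apply: cvgr_dist_lt e0; exact: cvg_id.
Unshelve. all: by end_near. Qed.

Lemma norm_rc_Re z : `|z| = rc (complex.Re `|z|).
Proof. by rewrite normc_def. Qed.

Lemma continuous_real_norm : continuous (fun z : C R => complex.Re `|z|).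
Proof.
move=> z; apply: continuous_cvg; first exact: continuous_Re.
by apply: cvg_norm; exact: cvg_id.
Qed.

Lemma continuous_coord1 : continuous (fun x : C3 R => x.1.1).
Proof.
move=> x; have h := @continuous_comp _ _ _ fst fst x
  (@continuous_fst _ _ x) (@continuous_fst _ _ x.1).
exact: h.
Qed.

Lemma continuous_coord2 : continuous (fun x : C3 R => x.1.2).
Proof.
move=> x; have h := @continuous_comp _ _ _ fst snd x
  (@continuous_fst _ _ x) (@continuous_snd _ _ x.1).
exact: h.
Qed.

Lemma continuous_coord3 : continuous (fun x : C3 R => x.2).
Proof. by move=> x; exact: continuous_snd. Qed.

Lemma closed_dist_boundary : closed (@dist_boundary R).
Proof.
pose F (x : C3 R) : R := complex.Re `|x.1.1 - x.1.2^* * x.2|.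
pose G (x : C3 R) : R := complex.Re `|x.2|.
pose H (x : C3 R) : R := complex.Re `|x.1.2|.
have cF : continuous F.
  move=> x; apply: (continuous_cvg _ (@continuous_real_norm _)).
  apply: cvgB; first exact: continuous_coord1.
  apply: cvgM; last exact: continuous_coord3.
  exact: (continuous_cvg _ (@continuous_conj _) (@continuous_coord2 x)).
have cG : continuous G.
  by move=> x; apply: (continuous_cvg _ (@continuous_real_norm _)); exact: continuous_coord3.
have cH : continuous H.
  by move=> x; apply: (continuous_cvg _ (@continuous_real_norm _)); exact: continuous_coord2.
have -> : @dist_boundary R =
    (F @^-1` [set 0]) `&` (G @^-1` [set 1]) `&` (H @^-1` [set r | r <= 1]).
  apply/seteqP; split => x.
    move=> [e1 e2 e3]; split; first split => /=.
    - by rewrite /F e1 subrr normr0.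
    - by rewrite /G e2.
    - by move: e3; rewrite /= norm_rc_Re (rc_le _ 1).
  move=> [[/= e1 e2] e3]; split.
  - by apply/eqP; rewrite -subr_eq0 -normr_eq0 norm_rc_Re; move: e1; rewrite /F => ->.
  - by rewrite norm_rc_Re -/(G x) e2.
  - by rewrite norm_rc_Re (rc_le _ 1).
have pre (g : C3 R -> R) A : continuous g -> closed A -> closed (g @^-1` A).
  by move=> /continuous_closedP; exact.
apply: closedI; last by apply: pre => //; exact: closed_le.
by apply: closedI; apply: pre => //; exact: closed_eq.
Qed.

Lemma C3_cvg_unique (T : Type) (F : set_system T) (FF : ProperFilter F)
    (f : T -> C3 R) (l m : C3 R) :
  f @ F --> l -> f @ F --> m -> l = m.
Proof.
move=> fl fm.
have h (g : C3 R -> C R) : continuous g -> g l = g m.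
  move=> cg; have gl : g (f t) @[t --> F] --> g l by apply: continuous_cvg fl; exact: cg.
  have gm : g (f t) @[t --> F] --> g m by apply: continuous_cvg fm; exact: cg.
  by apply: (cvg_unique _ gl gm); exact: norm_hausdorff.
move: (h _ continuous_coord1) (h _ continuous_coord2) (h _ continuous_coord3).
by case: l m {h fl fm} => [[? ?] ?] [[? ?] ?] /= -> -> ->.
Qed.

(** A nonempty open interval has positive measure, so it is not contained in a null set. *)
Lemma ae_dense_itv (P : R -> Prop) (a b : R) : a < b ->
  {ae @lebesgue_measure R, forall t, a <= t <= b -> P t} ->
  forall t, a <= t <= b -> closure [set s | a <= s <= b /\ P s] t.
Proof.
move=> ab [N [mN N0 PN]] t tab B /nbhs_ballP[e /= e0 eB].
pose c := Num.max a (t - e); pose d := Num.min b (t + e).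
have cd : c < d by rewrite lt_min !gt_max; lra.
apply: contrapT => nPB.
have sN : `]c, d[%classic `<=` N.
  move=> s /=; rewrite in_itv /= gt_max lt_min => /andP[/andP[h1 h2] /andP[h3 h4]].
  apply: PN => /= Ps; apply: nPB; exists s; split; first by split; [lra|apply: Ps; lra].
  by apply: eB; rewrite /ball /= ltr_norml; lra.
have : (@lebesgue_measure R `]c, d[%classic <= @lebesgue_measure R N)%E.
  by apply: le_measure => //; rewrite inE //; exact: measurable_itv.
rewrite N0 lebesgue_measure_itv /= lte_fin cd -EFinB lee_fin.
by rewrite subr_le0 leNgt cd.
Qed.

(** By continuity the radial limit at a point of the circle is the value of [x] there. It lies in
    the distinguished boundary for a dense set of angles, hence for all of them, the boundary being
    closed. *)
Lemma tetra_inner_boundary (x : C R -> C3 R) : tetra_inner x ->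
  forall z, `|z| = 1 -> dist_boundary (x z).
Proof.
move=> [_ _ _ ae xc] z /circle_cis[t0 t0I ->].
have c1 t : closed_disc (cis t : C R) by rewrite /closed_disc /= norm_cis.
have pi0 := pi_gt0 R; have p0 : (0 : R) < 2 * pi by lra.
pose y (t : R) := x (cis t).
have yc : continuous y.
  move=> t; have := @within_cvg _ _ _ _ _ _ _ (@cis R) _ xc (c1 t) (@continuous_cis R t).
  by apply; near=> s; exact: c1.
have cl : closed (y @^-1` (@dist_boundary R)).
  by move/continuous_closedP : yc; apply; exact: closed_dist_boundary.
apply: (cl t0); have := ae_dense_itv p0 ae t0I; apply: closure_subset.
move=> t [tI [l lb xl]] /=.
have xy : x (rc r * cis t) @[r --> (1 : R)^'-] --> y t.
  have rt : (rc r * cis t) @[r --> (1 : R)^'-] --> (cis t : C R).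
    rewrite -[X in _ --> X]mul1r; apply: cvgM; last exact: cvg_cst.
    by apply: cvg_Complex; [exact: cvg_at_left_filter cvg_id|exact: cvg_cst].
  have := @within_cvg _ _ _ _ _ _ (at_left_proper_filter _)
    (fun r => rc r * cis t) _ xc (c1 t) rt.
  apply; near=> r; rewrite /closed_disc /= normrM norm_cis mulr1.
  have r0 : 0 < r by near: r; exact: nbhs_left_gt.
  by rewrite ger0_norm ?(rc_le 0) ?(rc_le _ 1) //; exact: ltW.
have yl : y t = l.
  have PF := at_left_proper_filter (1 : R).
  exact: (@C3_cvg_unique _ _ PF _ _ _ xy xl).
by rewrite /preimage /= yl.
Unshelve. all: by end_near. Qed.

(** If |x2| > 1, the defining expression vanishes at z = 0, w = 1 / x2. *)
Lemma tetrablock_norm2 (x : C3 R) : closed_tetrablock x -> `|x.1.2| <= 1.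
Proof.
move=> h; rewrite real_leNgt ?normr_real ?real1 //; apply/negP => h1.
have x0 : x.1.2 != 0 by rewrite -normr_gt0; apply: lt_trans h1.
have := h 0 (x.1.2)^-1; rewrite /disc /= normr0 ltr01 normfV invf_lt1 ?h1 ?normr_gt0 //.
by move=> /(_ isT isT); rewrite !mulr0 mul0r subr0 addr0 divff // subrr eqxx.
Qed.

(** With a = x1 and c = x3, a zero of the defining expression means 1 - a z = w c (conj(a) - z). As
    |conj(a) - z| <= |1 - a z| for |a| <= 1, this contradicts |w| < 1. *)
Lemma dist_boundary_tetrablock (x : C3 R) : dist_boundary x -> closed_tetrablock x.
Proof.
move=> [e1 e2 e3] z w /= z1 w1; apply/eqP => e.
set a := x.1.1 in e1 e; set b := x.1.2 in e1 e3 e; set c := x.2 in e1 e2 e.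
have cc := circle_mulJ e2.
have a1 : `|a| <= 1 by rewrite e1 normrM norm_conjC e2 mulr1.
have az : 0 < `|1 - a * z|.
  rewrite normr_gt0 subr_eq0; apply/eqP => /(congr1 Num.norm) /eqP.
  rewrite normr1 normrM eq_sym; apply/negP; rewrite lt_eqF //.
  by apply: le_lt_trans z1; rewrite ler_piMl.
have bE : b = a^* * c.
  by rewrite e1 rmorphM /= conjCK -mulrA [_^* * _]mulrC cc mulr1.
have e' : 1 - a * z = w * c * (a^* - z).
  by apply/eqP; rewrite -subr_eq0 -e bE; apply/eqP; ring.
have nz : `|1 - a * z| ^+ 2 - `|a^* - z| ^+ 2 = (1 - `|a| ^+ 2) * (1 - `|z| ^+ 2).
  by rewrite !normCK !rmorphB rmorph1 rmorphM /= conjCK; ring.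
have le : `|a^* - z| <= `|1 - a * z|.
  rewrite -(ler_pXn2r (isT : (0 < 2)%N)) ?nnegrE // -subr_ge0 nz.
  by rewrite mulr_ge0 // subr_ge0 exprn_ile1 // ltW.
have : `|1 - a * z| < `|1 - a * z|.
  rewrite {1}e' !normrM e2 mulr1; apply: le_lt_trans (ler_wpM2l _ le) _ => //.
  by rewrite gtr_pMl.
by rewrite ltxx.
Qed.

End Boundary.

(** * Winding numbers *)

Section Winding.
Variable R : realType.
Implicit Types (z w u v : C R) (f g : C R -> C R).

Lemma continuous_Im : continuous (@complex.Im R : C R -> R).
Proof.
have -> : @complex.Im R = fun z : C R => complex.Re (z * Complex 0 (-1)).
  by apply/funext => -[a b] /=; rewrite mulr0 mulrN1 opprK add0r.
move=> z; apply: (continuous_cvg _ (@continuous_Re R _)).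
by apply: cvgM; [exact: cvg_id|exact: cvg_cst].
Qed.

(* Two loops are related when the argument of their quotient is single-valued. *)
Definition same_winding f g : Prop := exists theta : R -> R,
  [/\ continuous theta, theta (2 * pi) = theta 0
    & forall t, f (cis t) = g (cis t) * cis (theta t)].

Lemma cis0 : cis (0 : R) = 1. Proof. by rewrite /cis cos0 sin0. Qed.

Lemma cis2pi : cis (2 * pi : R) = 1.
Proof. by rewrite mulr_natl /cis cos2pi sin2pi. Qed.

Lemma same_winding_refl f : same_winding f f.
Proof.
exists (fun=> 0); split=> //; first by move=> t; exact: cvg_cst.
by move=> t; rewrite cis0 mulr1.
Qed.

Lemma same_winding_trans f g h :
  same_winding f g -> same_winding g h -> same_winding f h.
Proof.
move=> [a [ac ap aE]] [b [bc bp bE]]; exists (fun t => b t + a t); split.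
- by move=> t; apply: cvgD; [exact: bc|exact: ac].
- by rewrite ap bp.
- by move=> t; rewrite aE bE cisD mulrA.
Qed.

Lemma same_windingM f1 g1 f2 g2 : same_winding f1 g1 -> same_winding f2 g2 ->
  same_winding (fun z => f1 z * f2 z) (fun z => g1 z * g2 z).
Proof.
move=> [a [ac ap aE]] [b [bc bp bE]]; exists (fun t => a t + b t); split.
- by move=> t; apply: cvgD; [exact: ac|exact: bc].
- by rewrite ap bp.
- by move=> t; rewrite aE bE cisD mulrACA.
Qed.

Lemma same_winding_prod n (f g : 'I_n -> C R -> C R) :
  (forall i, same_winding (f i) (g i)) ->
  same_winding (fun z => \prod_i f i z) (fun z => \prod_i g i z).
Proof.
elim: n f g => [|n IH] f g h.
  rewrite (_ : (fun z => _) = (fun z => \prod_(i < 0) g i z)).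
    exact: same_winding_refl.
  by apply/funext => z; rewrite !big_ord0.
have E (k : 'I_n.+1 -> C R -> C R) : (fun z => \prod_i k i z) =
    (fun z => k ord0 z * (\prod_i k (lift ord0 i) z)).
  by apply/funext => z; rewrite big_ord_recl.
by rewrite !E; apply: same_windingM; [exact: h|apply: IH => i; exact: h].
Qed.

Lemma continuous_quotient_arg (w : R -> C R) : continuous w ->
  (forall t, 0 < complex.Re (w t)) ->
  continuous (fun t => atan (complex.Im (w t) / complex.Re (w t))).
Proof.
move=> cw w0 t; apply: (continuous_cvg _ (@continuous_atan R _)).
apply: cvgM; first by apply: continuous_cvg; [exact: continuous_Im|exact: cw].
apply: cvgV; first by rewrite gt_eqF.
by apply: continuous_cvg; [exact: continuous_Re|exact: cw].
Qed.

(** The quotient [w] of the two loops stays within distance 1 of the point 1, hence in the right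
    half plane. Its argument there is a function of [w] alone, so it returns to its initial
    value. *)
Lemma same_winding_close f g : continuous (f \o cis) -> continuous (g \o cis) ->
  (forall z, `|z| = 1 -> `|f z| = 1) -> (forall z, `|z| = 1 -> `|g z| = 1) ->
  (forall z, `|z| = 1 -> `|f z - g z| < 1) -> same_winding f g.
Proof.
move=> fc gc f1 g1 fg.
pose w t := f (cis t) * (g (cis t))^*.
have gg t : g (cis t) * (g (cis t))^* = 1 by rewrite circle_mulJ // g1 // norm_cis.
have w0 t : 0 < complex.Re (w t).
  have : `|1 - w t| < 1.
    rewrite (_ : 1 - w t = (g (cis t) - f (cis t)) * (g (cis t))^*);
      last by rewrite mulrBl gg.
    rewrite normrM norm_conjC (g1 (cis t)) ?norm_cis // mulr1.
    by rewrite distrC fg // norm_cis.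
  have := normc_ge_Re (1 - w t); case: (w t) => a b /= h1 h2.
  have : rc `|1 - a| < rc 1 by apply: le_lt_trans h1 h2.
  by rewrite rc_lt ltr_norml => /andP[]; lra.
have wc : continuous w.
  move=> t; apply: cvgM; first exact: fc.
  by apply: continuous_cvg; [exact: continuous_conj|exact: gc].
exists (fun t => atan (complex.Im (w t) / complex.Re (w t))); split.
- exact: continuous_quotient_arg.
- by rewrite /w cis2pi cis0.
- move=> t; have w1 : `|w t| = 1 by rewrite normrM norm_conjC f1 ?g1 ?norm_cis ?mulr1.
  have := cis_arg (w0 t); rewrite w1 mul1r => <-.
  by rewrite /w mulrCA gg mulr1.
Qed.

(** On the circle z - a = z conj(w) with w = 1 - conj(a) z in the right half plane, so the factor is
    z times [cis] of minus twice the argument of w. *)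
Lemma same_winding_blaschke_factor a : `|a| < 1 ->
  same_winding (fun z => (z - a) / (1 - a^* * z)) id.
Proof.
move=> a1; pose w (t : R) : C R := 1 - a^* * cis t.
have w0 t : 0 < complex.Re (w t).
  have : `|1 - w t| < 1
    by rewrite /w opprB addrCA subrr addr0 normrM norm_cis norm_conjC mulr1.
  have := normc_ge_Re (1 - w t); case: (w t) => x y /= h1 h2.
  have : rc `|1 - x| < rc 1 by apply: le_lt_trans h1 h2.
  by rewrite rc_lt ltr_norml => /andP[]; lra.
have wc : continuous w.
  move=> t; apply: cvgB; first exact: cvg_cst.
  by apply: cvgM; [exact: cvg_cst|exact: continuous_cis].
pose al t := atan (complex.Im (w t) / complex.Re (w t)).
have alc : continuous al by exact: continuous_quotient_arg.
exists (fun t => - (al t + al t)); split.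
- by move=> t; apply: cvgN; apply: cvgD; exact: alc.
- by rewrite /al /w cis2pi cis0.
- move=> t; have wE := cis_arg (w0 t); rewrite -/(al t) in wE.
  have nw : `|w t| != 0
    by rewrite normr_eq0; apply/eqP => w00; have := w0 t; rewrite w00 ltxx.
  have cc := circle_mulJ (norm_cis t); have ca := circle_mulJ (norm_cis (al t)).
  have cn : cis (al t) != 0 by rewrite -normr_gt0 norm_cis.
  have -> : cis t - a = cis t * (w t)^*.
    by rewrite /w rmorphB rmorph1 rmorphM /= conjCK mulrBr mulr1 mulrCA cc mulr1.
  have wJ : (w t)^* = `|w t| * (cis (al t))^*.
    by rewrite {1}wE rmorphM /= conj_normC.
  have civ : (cis (al t))^-1 = (cis (al t))^* by apply: (mulfI cn); rewrite mulfV // ca.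
  rewrite -/(w t) wJ {2}wE cisN cisD rmorphM invfM civ /=.
  by field.
Qed.

(** The difference [g] of the arguments is continuous with [cos (g t) = 1] throughout, and changes
    by 2 pi (N - n) over a period. If [N] and [n] differ, it takes a value at distance pi from
    [g 0], where the cosine is -1. *)
Lemma same_winding_exp_unique (c : C R) (N n : nat) : `|c| = 1 ->
  same_winding (fun z => c * z ^+ N) (fun z => z ^+ n) -> N = n.
Proof.
move=> /circle_cis[t0 _ ->] [th [thc thp thE]].
have cX m t : cis t ^+ m = cis (m%:R * t) :> C R.
  elim: m => [|m IH]; first by rewrite mul0r cis0.
  by rewrite exprSr IH -cisD -[m.+1]addn1 natrD mulrDl mul1r.
pose g t : R := t0 + N%:R * t - n%:R * t - th t.
have g1 t : cos (g t) = 1.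
  have : cis (g t) = 1.
    have h := thE t; rewrite !cX -cisD in h.
    rewrite (_ : g t = (t0 + N%:R * t) - (n%:R * t + th t)); last by rewrite /g; ring.
    by rewrite cisD h cisN cisD circle_mulJ // -cisD norm_cis.
  by case.
have gc : continuous g.
  have lin (k : R) : continuous (fun t : R => k * t).
    by move=> t; apply: cvgM; [exact: cvg_cst|exact: cvg_id].
  move=> t; apply: cvgB; last exact: thc.
  apply: cvgB; last exact: lin.
  by apply: cvgD; [exact: cvg_cst|exact: lin].
have gd : g (2 * pi) - g 0 = (N%:R - n%:R) * (2 * pi) by rewrite /g thp !mulr0; ring.
have pi0 := pi_gt0 R.
have ivt (v : R) :
    Num.min (g 0) (g (2 * pi)) <= v <= Num.max (g 0) (g (2 * pi)) -> cos v = 1.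
  have p0 : 0 <= 2 * pi :> R by lra.
  have gw : {within `[0, 2 * pi], continuous g} by exact: continuous_subspaceT.
  by move=> /(IVT p0 gw)[s _ <-].
have [Nn|nN|//] := ltngtP N n; exfalso.
- have d : (N%:R + 1 : R) <= n%:R by rewrite natr1 ler_nat.
  have d2 : (n%:R - N%:R - 1) * (2 * pi) >= 0 :> R by rewrite mulr_ge0 //; lra.
  have := ivt (g 0 - pi); rewrite ge_min le_max.
  have -> : g (2 * pi) <= g 0 - pi by lra.
  have -> : g 0 - pi <= g 0 by lra.
  rewrite orbT /= => /(_ isT); rewrite cosB cospi sinpi g1; lra.
- have d : (n%:R + 1 : R) <= N%:R by rewrite natr1 ler_nat.
  have d2 : (N%:R - n%:R - 1) * (2 * pi) >= 0 :> R by rewrite mulr_ge0 //; lra.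
  have := ivt (g 0 + pi); rewrite ge_min le_max.
  have -> : g 0 + pi <= g (2 * pi) by lra.
  have -> : g 0 <= g 0 + pi by lra.
  rewrite orbT /= => /(_ isT); rewrite cosD cospi sinpi g1; lra.
Qed.

End Winding.

(** * Homotopy invariance of the winding number *)

Section Homotopy.
Variable R : realType.
Implicit Types (z w u v : C R).

(** By compactness of the rectangle of parameters and angles, loops whose parameters differ by less
    than some [d] are at distance less than 1 at each point. Finitely many steps of length 1 / N < d
    then lead from parameter 0 to parameter 1. *)
Lemma homotopy_same_winding (h : R * C R -> C R) :
  {within [set sz | 0 <= sz.1 <= 1 /\ circle sz.2], continuous h} ->
  (forall s z, 0 <= s <= 1 -> circle z -> `|h (s, z)| = 1) ->
  same_winding (fun z => h (0, z)) (fun z => h (1, z)).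
Proof.
set A := [set sz | _] => hc h1.
have ct (t : R) : circle (cis t : C R) by rewrite /circle /= norm_cis.
have pi0 := pi_gt0 R.
have p2 : 0 <= 2 * pi :> R by lra.
pose e (p : R * R) : R * C R := (p.1, cis p.2).
have ec : continuous e.
  move=> p; have e1 : q.1 @[q --> p] --> p.1 by exact: continuous_fst.
  have e2 : cis q.2 @[q --> p] --> (cis p.2 : C R).
    by apply: continuous_cvg; [exact: continuous_cis|exact: continuous_snd].
  exact: cvg_pair e1 e2.
pose K : set (R * R) := `[0, 1]%classic `*` `[0, 2 * pi]%classic.
have Kc : compact K by apply: compact_setX; exact: segment_compact.
(* The covering argument runs over full neighborhoods of the points of [K], whereas [h] is only
   continuous within [A]; the guards on [p.1] and [s] keep both parameters in [0, 1]. *)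
pose P (d : R) (p : R * R) := 0 <= p.1 <= 1 ->
  forall s, 0 <= s <= 1 -> `|s - p.1| < d ->
  `|h (s, cis p.2) - h (p.1, cis p.2)| < 1.
have : \forall d \near (0 : R)^'+, K `<=` P d.
  move/compact_near_coveringP : Kc; apply=> -[s t] [/= sI tI].
  rewrite in_itv /= in sI; rewrite in_itv /= in tI.
  have Ae : A (e (s, t)) by split => /=; [exact: sI|exact: ct].
  have /subspace_continuousP/(_ _ Ae) hcs := hc.
  have half0 : (0 : C R) < 2^-1 by rewrite invr_gt0 ltr0n.
  have V : \forall q \near e (s, t), A q -> `|h (e (s, t)) - h q| < 2^-1.
    exact: (cvgr_dist_lt _ _ hcs _ half0).
  have W : \forall p \near (s, t), A (e p) -> `|h (e (s, t)) - h (e p)| < 2^-1.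
    exact: (ec (s, t) _ V).
  have [r /= r0 rW] := (nbhs_ballP _ _).1 W.
  have r2 : 0 < r / 2 by lra.
  near=> p d => p1I s' s'I sd.
  have [b1 b2] : ball (s, t) (r / 2) p by near: p; exact: nbhsx_ballx.
  have dr : d < r / 2 by near: d; exact: nbhs_right_lt.
  have W1 : `|h (e (s, t)) - h (e p)| < 2^-1.
    apply: rW; last by split => //; exact: ct.
    by split; [move: b1|move: b2]; rewrite /ball /=; lra.
  have W2 : `|h (e (s, t)) - h (e (s', p.2))| < 2^-1.
    apply: rW; last by split => //; exact: ct.
    split; last by move: b2; rewrite /ball /=; lra.
    move: b1 sd; rewrite /ball /= !ltr_norml; lra.
  rewrite (_ : _ - _ =
    (h (e (s, t)) - h (e p)) - (h (e (s, t)) - h (e (s', p.2)))); last first.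
    by rewrite /e /=; ring.
  apply: le_lt_trans (ler_normB _ _) _.
  have e1 : 2^-1 + 2^-1 = 1 :> C R by field.
  by rewrite -e1 ltrD.
move=> Hd; have [d Kd d0] : exists2 d, K `<=` P d & 0 < d.
  have PF := at_right_proper_filter (0 : R).
  by have [d []] := filter_ex (filterI Hd (nbhs_right_gt (0 : R))); exists d.
pose N := (Num.truncn d^-1).+1.
have N0 : 0 < N%:R :> R by rewrite ltr0n.
have Nd : N%:R^-1 < d by rewrite invf_plt ?posrE // truncnS_gt.
have sl (s : R) : 0 <= s <= 1 -> continuous ((fun z => h (s, z)) \o cis).
  move=> sI t; have As : A (s, cis t) by split; [|exact: ct].
  have cp : (s, cis t') @[t' --> t] --> (s, cis t : C R).
    have e2 : cis t' @[t' --> t] --> (cis t : C R) by exact: continuous_cis.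
    have e1 : (fun=> s) @ t --> s by exact: cvg_cst.
    exact: cvg_pair e1 e2.
  have := @within_cvg _ _ _ _ _ _ _ (fun t' => (s, cis t')) _ hc As cp; apply.
  by near=> t'; split; [|exact: ct].
have step i : (i <= N)%N ->
    same_winding (fun z => h (0, z)) (fun z => h (i%:R / N%:R, z)).
  elim: i => [_|i IH iN]; first by rewrite mul0r; exact: same_winding_refl.
  apply: same_winding_trans (IH (ltnW iN)) _.
  have iI : 0 <= (i%:R / N%:R : R) <= 1.
    by rewrite divr_ge0 //= ler_pdivrMr // mul1r ler_nat ltnW.
  have jI : 0 <= (i.+1%:R / N%:R : R) <= 1.
    by rewrite divr_ge0 //= ler_pdivrMr // mul1r ler_nat.
  apply: same_winding_close => [||z z1|z z1|z /circle_cis[t tI ->]];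
    try exact: sl; try exact: h1.
  have Kt : K (i%:R / N%:R, t) by split => /=; rewrite in_itv.
  rewrite distrC; apply: (Kd _ Kt) => //=.
  rewrite -mulrBl -natr1 addrAC subrr add0r mul1r ger0_norm ?invr_ge0 //.
have := step N (leqnn _).
by rewrite divff // gt_eqF.
Unshelve. all: by end_near. Qed.

End Homotopy.

(** * Structure of rational tetra-inner functions *)

Section Structure.
Variable R : realType.
Implicit Types (z w u v : C R) (p q D E : {poly C R}).

(** The third coordinate is unimodular on the distinguished boundary, so it carries the homotopy to
    one of loops in the circle. *)
Lemma tetra_degree_winding (x : C R -> C3 R) (n : nat) : tetra_degree x n%:Z ->
  same_winding (fun z => (x z).2) (fun z => z ^+ n).
Proof.
move=> [H [Hc Hb H0 H1]].
have ct (t : R) : circle (cis t : C R) by rewrite /circle /= norm_cis.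
have hc : {within [set sz : R * C R | 0 <= sz.1 <= 1 /\ circle sz.2],
    continuous (fun sz => (H sz).2)}.
  apply/subspace_continuousP => sz szA.
  have /subspace_continuousP/(_ _ szA) h := Hc.
  by apply: continuous_cvg h; exact: continuous_coord3.
have [|theta [tc tp tE]] := homotopy_same_winding hc.
  by move=> s z sI zI; have [] := Hb s z sI zI.
exists theta; split=> // t; have := tE t.
by rewrite H0 ?H1 //; exact: ct.
Qed.

Lemma same_winding_conj_rev N q : (size q <= N.+1)%N ->
  (forall z, `|z| <= 1 -> q.[z] != 0) ->
  exists2 c, `|c| = 1 &
  same_winding (fun z => (conj_rev N q).[z] / q.[z]) (fun z => c * z ^+ N).
Proof.
move=> sq qd; have [a [a1 qE rE]] := blaschke_factorization sq qd.
have q0 := horner0_neq0 qd; pose c := (q.[0])^* / q.[0].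
exists c; first by rewrite normrM normfV norm_conjC divff // normr_eq0.
rewrite (_ : (fun z => _) = (fun z => c * \prod_i ((z - a i) / (1 - (a i)^* * z)))).
  rewrite (_ : (fun z => c * z ^+ N) = (fun z => c * \prod_(i < N) z)).
    apply: same_windingM; first exact: same_winding_refl.
    by apply: same_winding_prod => i; exact: same_winding_blaschke_factor.
  by apply/funext => z; rewrite prodr_const card_ord.
apply/funext => z; rewrite rE {2}qE !hornerZ !horner_prod prodf_div invfM mulrACA.
congr (_ * (_ / _)); apply: eq_bigr => i _; rewrite !hornerE //.
Qed.

(** The third coordinate provides [D], the relation on the circle makes [D] a denominator of the
    second coordinate with numerator [E], and the first coordinate follows from the other two. *)
Lemma tetra_inner_structure (x : C R -> C3 R) (n : nat) :
  tetra_inner x -> tetra_degree x n%:Z -> exists D E,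
  [/\ (size D <= n.+1)%N, (size E <= n.+1)%N, forall z, `|z| <= 1 -> D.[z] != 0
    & forall z, `|z| <= 1 ->
      x z = ((conj_rev n E).[z] / D.[z], E.[z] / D.[z], (conj_rev n D).[z] / D.[z])].
Proof.
move=> xi xd; have xb := tetra_inner_boundary xi.
have [_ [r1 r2 r3] _ _ xc] := xi.
have coordc (g : C3 R -> C R) : continuous g -> {within closed_disc, continuous (g \o x)}.
  move=> gc; apply/subspace_continuousP => z zA.
  have /subspace_continuousP/(_ _ zA) h := xc.
  by apply: continuous_cvg h; exact: gc.
have [p1 [q1 [c1 q1d x1E]]] := rational_closed_disc r1 (coordc _ (@continuous_coord1 R)).
have [p2 [q2 [c2 q2d x2E]]] := rational_closed_disc r2 (coordc _ (@continuous_coord2 R)).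
have [p3 [q3 [c3 q3d x3E]]] := rational_closed_disc r3 (coordc _ (@continuous_coord3 R)).
have [||N [c [cu sq3 p3E]]] := unimodular_ratio c3.
- by move=> z z1; apply: q3d; rewrite z1.
- move=> z z1; have [_ + _] := xb z z1; rewrite x3E ?z1 // normf_div => e.
  by rewrite -[RHS]mul1r -e divfK // normr_eq0 q3d ?z1.
(* The winding number of x3 is [n] by the topological degree, and [N] because q3~ / q3 is a constant
   times a Blaschke product of [N] factors. *)
have Nn : N = n.
  have [b b1 h] := same_winding_conj_rev sq3 q3d.
  apply: (@same_winding_exp_unique _ (c * b)); first by rewrite normrM cu b1 mulr1.
  have [a [ac ap aE]] := same_windingM (same_winding_refl (fun=> c)) h.
  have [d [dc dp dE]] := tetra_degree_winding xd.
  exists (fun t => d t - a t); split.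
  - by move=> t; apply: cvgB; [exact: dc|exact: ac].
  - by rewrite dp ap.
  - move=> t; rewrite cisD mulrA -dE x3E ?norm_cis // p3E hornerZ.
    rewrite -mulrA -[in RHS]mulrA.
    have := aE t; rewrite /= => ->.
    by rewrite -!mulrA -cisD subrr cis0 mulr1.
subst N.
(* Scaling the denominator by [d] multiplies q3~ / q3 by [d^* / d], which is the square of [d^*],
   that is [c]: the constant is absorbed. *)
pose d := sqrtC c^*.
have dd : d * d = c^* by rewrite -expr2 sqrtCK.
have d1 : `|d| = 1.
  by apply/eqP; rewrite -sqrp_eq1 // expr2 -normrM dd norm_conjC cu.
have d0 := circle_neq0 d1; have dJ := circle_mulJ d1.
pose D := d *: q3.
have Dd z : `|z| <= 1 -> D.[z] != 0 by move=> z1; rewrite hornerZ mulf_neq0 // q3d.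
have sD : (size D <= n.+1)%N by rewrite size_scale.
have x3D z : `|z| <= 1 -> (x z).2 = (conj_rev n D).[z] / D.[z].
  move=> z1; rewrite x3E // p3E conj_revZ !hornerZ -[c]conjCK -dd rmorphM /=.
  have := q3d z z1 => qz.
  have dV : d^-1 = d^* by apply: (mulfI d0); rewrite mulfV.
  by rewrite invfM dV; ring.
have [|E sE EE] := common_denominator c2 q1d q2d Dd sD (p1 := p1).
  move=> z z1; have zl : `|z| <= 1 by rewrite z1.
  have [e1 e3 _] := xb z z1; rewrite -x3D // -x1E // -x2E // e1 /=.
  by rewrite rmorphM /= conjCK -mulrA [_^* * _]mulrC circle_mulJ // mulr1.
have x2D z : `|z| <= 1 -> (x z).1.2 = E.[z] / D.[z].
  move=> z1; rewrite x2E //; have := congr1 (horner^~ z) EE; rewrite !hornerM => e.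
  by apply/eqP; rewrite eqr_div ?Dd ?q2d // mulrC -e.
(* The relation x1 = conj(x2) x3 holds on the circle only; as an identity of polynomials it extends
   to the disc. *)
have E1 : p1 * D = conj_rev n E * q1.
  apply: poly_eq_circle => z z1; have zl : `|z| <= 1 by rewrite z1.
  rewrite !hornerM conj_rev_circle //; have [e1 _ _] := xb z z1.
  move: e1; rewrite x1E // x2D // x3D // conj_rev_circle // rmorphM fmorphV /= => /eqP.
  have Dz := Dd z zl; have Dz' : (D.[z])^* != 0 by rewrite fmorph_eq0.
  rewrite mulrA (_ : _ / (D.[z])^* * _ = z ^+ n * (E.[z])^*); last by field.
  by rewrite eqr_div ?Dd ?q1d // => /eqP.
exists D, E; split=> // z z1; rewrite -x3D // -x2D //.
rewrite -(_ : (x z).1.1 = (conj_rev n E).[z] / D.[z]); first by case: (x z) => -[].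
rewrite x1E //; have := congr1 (horner^~ z) E1; rewrite !hornerM => e.
by apply/eqP; rewrite eqr_div ?Dd ?q1d // e.
Qed.

End Structure.

(** * First-order contact and phasar derivatives *)

Section Flat.
Variable R : realType.
Implicit Types (z w u v : C R) (p q : {poly C R}).

Lemma is_derive_slope (f : R -> R) (t d : R) :
  is_derive t 1 f d <-> (f (h + t) - f t) / h @[h --> (0 : R)^'] --> d.
Proof.
have E : (fun h : R => h^-1 *: ((f \o shift t) (h *: 1) - f t)) =
    (fun h => (f (h + t) - f t) / h).
  by apply/funext => h /=; rewrite /GRing.scale /= mulr1 mulrC.
split=> [[df <-]|h]; last apply: DeriveDef.
- by move: df; rewrite /derivable /derive E.
- by rewrite /derivable E; apply/cvg_ex; exists d.
- by rewrite /derive E; exact: cvg_lim h.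
Qed.

Lemma cvg_shift_dnbhs (t : R) : h + t @[h --> (0 : R)^'] --> t.
Proof.
have c : h + t @[h --> (0 : R)] --> 0 + t by apply: cvgD; [exact: cvg_id|exact: cvg_cst].
by rewrite add0r in c; exact: cvg_within_filter c.
Qed.

Lemma near_shift_dnbhs (t : R) (P : R -> Prop) : (\forall s \near t, P s) ->
  \forall h \near (0 : R)^', P (h + t).
Proof. exact: cvg_shift_dnbhs. Qed.

(** First-order contact with 0 at [t]: f(s) = o(s - t). Unlike the vanishing of a derivative, this
    form passes by mere comparison of moduli from one function to another. *)
Definition flat (f : R -> C R) (t : R) : Prop :=
  f t = 0 /\ f (h + t) / rc h @[h --> (0 : R)^'] --> (0 : C R).

Lemma flat_le (f g : R -> C R) t :
  (\forall s \near t, `|f s| <= `|g s|) -> flat g t -> flat f t.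
Proof.
move=> fg [g0 gl]; split.
  by apply/eqP; rewrite -normr_le0; have := nbhs_singleton fg; rewrite g0 normr0.
apply/cvgr0Pnorm_lt => e e0; have fgh := near_shift_dnbhs fg.
near=> h.
have : `|g (h + t) / rc h| < e.
  by near: h; move/cvgr0Pnorm_lt : gl; exact.
apply: le_lt_trans; rewrite !normrM ler_wpM2r //.
by near: h.
Unshelve. all: by end_near. Qed.

Lemma flatD (f g : R -> C R) t : flat f t -> flat g t -> flat (fun s => f s + g s) t.
Proof.
move=> [f0 fl] [g0 gl]; split; first by rewrite f0 g0 addr0.
rewrite (_ : (fun h => _) = (fun h => f (h + t) / rc h + g (h + t) / rc h)).
  by have fgl := cvgD fl gl; rewrite addr0 in fgl; exact: fgl.
by apply/funext => h; rewrite mulrDl.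
Qed.

Lemma flatMr (f g : R -> C R) t : flat f t -> {for t, continuous g} ->
  flat (fun s => f s * g s) t.
Proof.
move=> [f0 fl] gc; split; first by rewrite f0 mul0r.
rewrite (_ : (fun h => _) = (fun h => (f (h + t) / rc h) * g (h + t))).
  have gt : g (h + t) @[h --> (0 : R)^'] --> g t.
    by apply: continuous_cvg; [exact: gc|exact: cvg_shift_dnbhs].
  by have fgl := cvgM fl gt; rewrite mul0r in fgl; exact: fgl.
by apply/funext => h; rewrite mulrAC.
Qed.

Lemma flat_is_derive (u v : R -> R) t : u t = 0 -> v t = 0 ->
  is_derive t 1 u 0 -> is_derive t 1 v 0 -> flat (fun s => Complex (u s) (v s)) t.
Proof.
move=> u0 v0 /is_derive_slope ul /is_derive_slope vl; split; first by rewrite u0 v0.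
rewrite (_ : (fun h => _) =
   (fun h => Complex ((u (h + t) - u t) / h) ((v (h + t) - v t) / h))).
  exact: (cvg_Complex _ ul vl).
apply/funext => h; rewrite u0 v0 !subr0 rcV.
by rewrite /rc; apply/eqP; rewrite eq_complex /= !mulr0 subr0 add0r !eqxx.
Qed.

Lemma flat_derive_Im (f : R -> C R) t : flat f t ->
  is_derive t 1 (fun s => complex.Im (f s)) 0.
Proof.
move=> [f0 fl]; apply/is_derive_slope; rewrite f0 /=.
rewrite (_ : (fun h => _) = (fun h => complex.Im (f (h + t) / rc h))).
  by apply: continuous_cvg fl; exact: continuous_Im.
by apply/funext => h; rewrite subr0 rcV; case: (f _) => a b /=; rewrite mulr0 add0r.
Qed.

Lemma cvg_slope_cis (t : R) :
  (cis (h + t) - cis t) / rc h @[h --> (0 : R)^'] --> (Complex 0 1 : C R) * cis t.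
Proof.
have /is_derive_slope c := is_derive_cos t.
have /is_derive_slope s := is_derive_sin t.
rewrite (_ : (fun h => _) =
   (fun h => Complex ((cos (h + t) - cos t) / h) ((sin (h + t) - sin t) / h))).
  rewrite (_ : (Complex 0 1 : C R) * cis t = Complex (- sin t) (cos t));
    first exact: cvg_Complex.
  by rewrite /cis; apply/eqP; rewrite eq_complex /= !mul0r !mul1r sub0r add0r !eqxx.
apply/funext => h; rewrite rcV.
by rewrite /rc /cis; apply/eqP; rewrite eq_complex /= !mulr0 subr0 add0r !eqxx.
Qed.

Lemma cvg_slope_horner_cis p (t : R) : p.[cis t] = 0 ->
  p.[cis (h + t)] / rc h @[h --> (0 : R)^'] -->
    (Complex 0 1 : C R) * cis t * p^`().[cis t].
Proof.
move=> /eqP/factor_theorem[k ->]; rewrite mulrC deriv_root_XsubC_mul.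
rewrite (_ : (fun h => _) =
   (fun h => (cis (h + t) - cis t) / rc h * k.[cis (h + t)])).
  apply: cvgM; first exact: cvg_slope_cis.
  apply: cvg_horner; apply: continuous_cvg; first exact: continuous_cis.
  exact: cvg_shift_dnbhs.
by apply/funext => h; rewrite hornerM hornerXsubC mulrAC.
Qed.

(** The velocity [Complex 0 1 * cis t] of [cis] is nonzero, so first-order contact along the circle
    amounts to a zero of order at least two. *)
Lemma flat_horner_cis p (t : R) :
  flat (fun s => p.[cis s]) t <-> p.[cis t] = 0 /\ p^`().[cis t] = 0.
Proof.
have ic : (Complex 0 1 : C R) * cis t != 0 :> C R.
  rewrite mulf_neq0 //; last by rewrite circle_neq0 // norm_cis.
  by rewrite eq_complex /= oner_eq0 andbF.
split=> [[p0 pl]|[p0 p1]]; split=> //.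
  have h := cvg_slope_horner_cis p0.
  have : (Complex 0 1 : C R) * cis t * p^`().[cis t] = 0.
    by apply: (cvg_unique _ h pl); exact: norm_hausdorff.
  by move=> /eqP; rewrite mulf_eq0 (negbTE ic) /= => /eqP.
by have := cvg_slope_horner_cis p0; rewrite p1 mulr0.
Qed.

(* A nonnegative function on the circle is minimal, hence stationary, at its zeros. *)
Lemma nonneg_circle_double_root p n z : `|z| = 1 ->
  (forall w, `|w| = 1 -> 0 <= (w^*) ^+ n * p.[w]) -> p.[z] = 0 -> p^`().[z] = 0.
Proof.
move=> /circle_cis[t _ ->] pp p0.
set L : C R := (cis t)^* ^+ n * ((Complex 0 1 : C R) * cis t * p^`().[cis t]).
pose g (s : R) : C R := (cis s)^* ^+ n * p.[cis s].
have gl : g (h + t) / rc h @[h --> (0 : R)^'] --> L.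
  rewrite (_ : (fun h => _) = (fun h => (cis (h + t))^* ^+ n * (p.[cis (h + t)] / rc h))).
    apply: cvgM; last exact: cvg_slope_horner_cis.
    rewrite (_ : (fun h => _) = (fun h => ('X^n).[(cis (h + t))^*])); last first.
      by apply/funext => h; rewrite hornerXn.
    rewrite -[X in _ --> X]hornerXn; apply: cvg_horner.
    apply: continuous_cvg; first exact: continuous_conj.
    by apply: continuous_cvg; [exact: continuous_cis|exact: cvg_shift_dnbhs].
  by apply/funext => h; rewrite /g mulrA.
have gp s : g s = rc (complex.Re (g s)) /\ 0 <= complex.Re (g s).
  have := pp (cis s) (norm_cis s); rewrite -/(g s); case: (g s) => a b.
  by rewrite lecE /= => /andP[/eqP -> a0].
have rl : complex.Re (g (h + t)) / h @[h --> (0 : R)^'] --> complex.Re L.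
  rewrite (_ : (fun h => _) = (fun h => complex.Re (g (h + t) / rc h))).
    by apply: continuous_cvg gl; exact: continuous_Re.
  apply/funext => h; rewrite rcV.
  by case: (g _) => a b /=; rewrite mulr0 subr0.
have il : complex.Im L = 0.
  have h1 : (fun=> 0) @ (0 : R)^' --> complex.Im L.
    rewrite (_ : (fun=> 0) = (fun h => complex.Im (g (h + t) / rc h))).
      by apply: continuous_cvg gl; exact: continuous_Im.
    apply/funext => h; have [-> _] := gp (h + t).
    by rewrite rcV -rcM.
  have h2 : (fun=> 0 : R) @ (0 : R)^' --> (0 : R) by exact: cvg_cst.
  by apply: (cvg_unique _ h1 h2); exact: norm_hausdorff.
have r1 : 0 <= complex.Re L.
  apply: (cvgr_to_ge (cvg_dnbhs_at_right rl)); near=> h.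
  have h0 : 0 < h by near: h; exact: nbhs_right_gt.
  by have [_ g0] := gp (h + t); rewrite divr_ge0 // ltW.
have r2 : complex.Re L <= 0.
  apply: (cvgr_to_le (cvg_dnbhs_at_left rl)); near=> h.
  have h0 : h < 0 by near: h; exact: nbhs_left_lt.
  by have [_ g0] := gp (h + t); rewrite mulr_ge0_le0 // invr_le0 ltW.
have : L = 0.
  by move: il r1 r2; rewrite /L; case: (_ * _) => a b /= -> a0 a1; congr Complex; lra.
move=> /eqP; rewrite /L !mulf_eq0 expf_eq0 fmorph_eq0.
rewrite (negbTE (circle_neq0 (norm_cis t))) andbF /= orbF.
by rewrite eq_complex /= oner_eq0 andbF /= => /eqP.
Unshelve. all: by end_near. Qed.

End Flat.

(** * Phasar derivatives and first-order contact *)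

Section Phasar.
Variable R : realType.
Implicit Types (z w u v : C R) (f g : C R -> C R).

Lemma is_derive_comp1 (a b : R -> R) (t r d : R) :
  is_derive t 1 a r -> is_derive (a t) 1 b d -> is_derive t 1 (b \o a) (d * r).
Proof.
move=> [da <-] [db <-]; apply: DeriveDef.
  by apply/derivable1_diffP; apply: differentiable_comp; apply/derivable1_diffP.
by rewrite -!derive1E derive1_comp.
Qed.

(** The definition offers a branch at some angle of [z]; the difference of two such angles is a
    period of [cis], so the branch can be translated to the prescribed one. *)
Lemma phasar_derivative_at f z (r t : R) : phasar_derivative f z r -> z = cis t ->
  exists a : R -> R, [/\ \forall s \near t,
      f (cis s) != 0 /\ f (cis s) = `|f (cis s)| * cis (a s)
    & is_derive t 1 a r].
Proof.
move=> [t0 [a [zt0 an ad]]] zt.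
have per s : cis (s + (t0 - t)) = cis s :> C R.
  by rewrite !cisD cisN -zt -zt0 circle_mulJ ?mulr1 // zt norm_cis.
exists (fun s => a (s + (t0 - t))); split.
  have c : s + (t0 - t) @[s --> t] --> t0.
    have c1 : s + (t0 - t) @[s --> t] --> t + (t0 - t).
      by apply: cvgD; [exact: cvg_id|exact: cvg_cst].
    by rewrite (_ : t + (t0 - t) = t0) in c1; last by ring.
  have cn : \forall s \near t, f (cis (s + (t0 - t))) != 0 /\
      f (cis (s + (t0 - t))) = `|f (cis (s + (t0 - t)))| * cis (a (s + (t0 - t))).
    exact: (c _ an).
  by near=> s; rewrite -(per s); near: s.
move/is_derive_slope : ad => ad; apply/is_derive_slope.
rewrite (_ : (fun h => _) = (fun h => (a (h + t0) - a t0) / h)) //.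
apply/funext => h; rewrite (_ : h + t + (t0 - t) = h + t0); last by ring.
by rewrite (_ : t + (t0 - t) = t0); last by ring.
Unshelve. all: by end_near. Qed.

(** Only the values of [cis] are compared at [t], since two branches of an argument may differ there
    by a multiple of 2 pi. *)
Lemma flat_cis_sub (a b : R -> R) (t r : R) : is_derive t 1 a r -> is_derive t 1 b r ->
  cis (a t) = cis (b t) :> C R -> flat (fun s => cis (a s) - cis (b s) : C R) t.
Proof.
move=> da db -[ec es].
have dc := is_deriveB (is_derive_comp1 da (is_derive_cos _))
  (is_derive_comp1 db (is_derive_cos _)).
have ds := is_deriveB (is_derive_comp1 da (is_derive_sin _))
  (is_derive_comp1 db (is_derive_sin _)).
rewrite es subrr in dc; rewrite ec subrr in ds.
apply: (flat_is_derive _ _ dc ds) => /=.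
  by rewrite fctE /= ec subrr.
by rewrite fctE /= es subrr.
Qed.

(** The quotient w = g / f is 1 up to a flat term, so atan (Im w / Re w) is a branch of its argument
    near [t] with derivative 0. Added to a branch for [f] it gives one for [g]. *)
Lemma phasar_derivative_flat f g z (r : R) :
  (forall t, z = cis t -> [/\ flat (fun s => g (cis s) - f (cis s)) t,
     {for t, continuous (f \o cis)} & {for t, continuous (g \o cis)}]) ->
  phasar_derivative f z r -> phasar_derivative g z r.
Proof.
move=> H [t [a [zt an ad]]]; have [fl fc gc] := H t zt.
have [f0 _] := nbhs_singleton an.
pose w s := g (cis s) / f (cis s).
have fVc : {for t, continuous (fun s => (f (cis s))^-1)} by exact: cvgV f0 fc.
have wc : {for t, continuous w} by exact: cvgM gc fVc.
have gf : g (cis t) = f (cis t) by apply/eqP; rewrite -subr_eq0; apply/eqP; exact: fl.1.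
have w1 : w t = 1 by rewrite /w gf divff.
have wfl : flat (fun s => w s - 1) t.
  apply: flat_le (flatMr fl fVc); apply: filterS an => s [fs _].
  by rewrite /w mulrBl divff.
have dI := flat_derive_Im wfl.
have ReC : {for t, continuous (fun s => complex.Re (w s))}.
  by apply: continuous_cvg wc; exact: continuous_Re.
pose y s := complex.Im (w s) / complex.Re (w s).
have y0 : y t = 0 by rewrite /y w1 /= mul0r.
have dy : is_derive t 1 y 0.
  apply/is_derive_slope; move/is_derive_slope : dI => dI.
  rewrite (_ : (fun h => _) = (fun h =>
     ((complex.Im (w (h + t) - 1) - complex.Im (w t - 1)) / h) *
     (complex.Re (w (h + t)))^-1)).
    have h2 : (complex.Re (w (h + t)))^-1 @[h --> (0 : R)^'] --> (complex.Re (w t))^-1.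
      apply: cvgV; first by rewrite w1 /= oner_eq0.
      exact: (cvg_comp _ _ (@cvg_shift_dnbhs R t) ReC).
    by have hh := cvgM dI h2; rewrite mul0r in hh; exact: hh.
  apply/funext => h; rewrite y0 subr0 /y w1 subrr /= subr0.
  by case: (w _) => ? ? /=; rewrite oppr0 addr0 mulrAC.
have db : is_derive t 1 (atan \o y) 0.
  by have := is_derive_comp1 dy (is_derive1_atan _); rewrite mulr0.
exists t, (a + (atan \o y)); split=> //.
  have Rep : \forall s \near t, 0 < complex.Re (w s).
    by apply: cvgr_gt ReC _ _; rewrite w1 /= ltr01.
  apply: filterS2 an Rep => s [fs fE] Res.
  have wE := cis_arg Res.
  have ws0 : w s != 0 by apply: contraTneq Res => ->; rewrite ltxx.
  have gE : g (cis s) = f (cis s) * w s by rewrite /w mulrCA divff // mulr1.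
  rewrite gE; split; first by rewrite mulf_neq0.
  by rewrite fctE /= cisD normrM {1}fE {1}wE mulrACA.
by rewrite -[r]addr0; exact: is_deriveD.
Qed.

(** The phasar derivative only controls arguments; flatness of [1 - |f|] and [1 - |g|] controls the
    moduli. With branches a and b, f - g = (cis a - cis b) - (1 - |f|) cis a + (1 - |g|) cis b is a
    sum of flat terms. *)
Lemma flat_of_phasar f g z (r t : R) : z = cis t ->
  phasar_derivative f z r -> phasar_derivative g z r -> f z = g z ->
  `|f z| = 1 ->
  flat (fun s => 1 - `|f (cis s)|) t -> flat (fun s => 1 - `|g (cis s)|) t ->
  flat (fun s => f (cis s) - g (cis s)) t.
Proof.
move=> zt fp gp fg f1 ff gf.
have [a [an ad]] := phasar_derivative_at fp zt.
have [b [bn bd]] := phasar_derivative_at gp zt.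
have [_ fE] := nbhs_singleton an; have [_ gE] := nbhs_singleton bn.
have ab : cis (a t) = cis (b t) :> C R.
  by move: fE gE; rewrite -zt -fg f1 !mul1r => <- <-.
have fl := flat_cis_sub ad bd ab.
have ff' : flat (fun s => (1 - `|f (cis s)|) * - cis (a s)) t.
  by apply: flat_le ff; near=> s; rewrite normrM normrN norm_cis mulr1.
have gf' : flat (fun s => (1 - `|g (cis s)|) * cis (b s)) t.
  by apply: flat_le gf; near=> s; rewrite normrM norm_cis mulr1.
apply: flat_le (flatD (flatD fl ff') gf').
near=> s.
have [_ fs] : f (cis s) != 0 /\ f (cis s) = `|f (cis s)| * cis (a s) by near: s.
have [_ gs] : g (cis s) != 0 /\ g (cis s) = `|g (cis s)| * cis (b s) by near: s.
rewrite {1}fs {1}gs (_ : _ - _ =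
  (cis (a s) - cis (b s) + (1 - `|f (cis s)|) * - cis (a s) +
    (1 - `|g (cis s)|) * cis (b s))) //.
by ring.
Unshelve. all: by end_near. Qed.

End Phasar.

(** * The royal polynomial and the interpolation problem *)

Section Quotients.
Variable R : realType.
Implicit Types (z w u v : C R) (p q : {poly C R}).

Lemma within_continuous_quotient p q (f : C R -> C R) :
  (forall z, `|z| <= 1 -> q.[z] != 0) ->
  (forall z, `|z| <= 1 -> f z = p.[z] / q.[z]) -> {within closed_disc, continuous f}.
Proof.
move=> qd fE; apply/subspace_continuousP => z z1.
have c : p.[w] / q.[w] @[w --> z] --> p.[z] / q.[z].
  apply: cvgM; first exact: continuous_horner_C.
  by apply: cvgV; [exact: qd|exact: continuous_horner_C].
have fz := fE z z1.
have cw : p.[w] / q.[w] @[w --> within closed_disc (nbhs z)] --> f z.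
  by rewrite fz; exact: cvg_within_filter c.
apply: cvg_trans cw; apply: near_eq_cvg.
near=> w; have w1 : closed_disc w by near: w; exact: withinT.
by rewrite /from_subspace (fE w).
Unshelve. all: by end_near. Qed.

Lemma continuous_quotient_cis p q (t : R) : q.[cis t] != 0 ->
  {for t, continuous (fun s => p.[cis s] / q.[cis s])}.
Proof.
move=> q0; have h (r : {poly C R}) : r.[cis s] @[s --> t] --> r.[cis t].
  by apply: cvg_horner; exact: continuous_cis.
by apply: cvgM; [exact: h|apply: cvgV; [exact: q0|exact: h]].
Qed.

Lemma finite_blaschke_conj_rev n c q (f : C R -> C R) : `|c| = 1 ->
  (size q <= n.+1)%N -> (forall z, `|z| <= 1 -> q.[z] != 0) ->
  (forall z, `|z| <= 1 -> f z = c * ((conj_rev n q).[z] / q.[z])) ->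
  finite_blaschke n f.
Proof.
move=> c1 sq qd fE; have [a [a1 qE rE]] := blaschke_factorization sq qd.
exists (c * ((q.[0])^* / q.[0])), a; split=> //.
  by rewrite /circle /= !normrM c1 mul1r normfV
    norm_conjC divff // normr_eq0 horner0_neq0.
move=> z z1; rewrite fE // rE {2}qE !hornerZ !horner_prod prodf_div -[RHS]mulrA;
congr (_ * _).
rewrite invfM mulrACA; congr (_ * (_ / _)); apply: eq_bigr => i _; rewrite !hornerE //.
Qed.

End Quotients.

(** * Zeros of the royal polynomial and of the denominator of Psi *)

Section RoyalInterpolation.
Variables (R : realType) (n k : nat) (hkn : (k <= n)%N).
Variables (sigma eta : 'I_n -> C R) (rho : 'I_k -> R).
Hypothesis hdata : blaschke_data hkn sigma eta rho.
Variables (etat : 'I_n -> C R) (x : C R -> C3 R).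
Hypothesis hx : royal_solution hkn sigma eta etat rho x.
Hypothesis hroyal : ~ (x @` closed_disc `<=` royal_variety).
Variables D E : {poly C R}.
Hypotheses (sD : (size D <= n.+1)%N) (sE : (size E <= n.+1)%N).
Hypothesis D_neq0 : forall z, `|z| <= 1 -> D.[z] != 0.
Hypothesis xE : forall z, `|z| <= 1 ->
  x z = ((conj_rev n E).[z] / D.[z], E.[z] / D.[z], (conj_rev n D).[z] / D.[z]).

Let royal_poly := conj_rev n D * D - conj_rev n E * E.
(** Each node comes with its reflection. On the circle the second factor is a multiple of the first,
    so the node is double; at the node 0 it is 1, the reflection being at infinity. *)
Let node_poly := \prod_j ('X - (sigma j)%:P) * \prod_j (1 - (sigma j)^* *: 'X).

Let sigma_disc (j : 'I_n) : `|sigma j| <= 1.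
Proof.
have [_ _ h1 h2 _] := hdata; have [jk|jk] := ltnP j k.
  by have [-> _] := h1 j jk.
by have [/ltW] := h2 j jk.
Qed.

Let E_le_D z : `|z| <= 1 -> `|E.[z]| <= `|D.[z]|.
Proof.
move=> z1; have Dz := D_neq0 z1.
have : `|(x z).1.2| <= 1.
  have [xi _ _ _] := hx; have [_ _ xt _ _] := xi.
  have [z2|z2] := boolP (`|z| < 1); first exact/tetrablock_norm2/xt.
  have /(tetra_inner_boundary xi)[_ _] // : `|z| = 1.
  by apply/eqP; move: z2; rewrite -real_leNgt ?normr_real // => z2; rewrite eq_le z1.
by rewrite xE //= normf_div ler_pdivrMr ?mul1r // normr_gt0.
Qed.

Let royal_polyE z : `|z| <= 1 ->
  royal_poly.[z] = D.[z] ^+ 2 * ((x z).2 - (x z).1.1 * (x z).1.2).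
Proof.
by move=> z1; rewrite xE //= /royal_poly !(hornerD, hornerN, hornerM);
field; exact: D_neq0.
Qed.

Let royal_poly_circle z : `|z| = 1 ->
  royal_poly.[z] = z ^+ n * (`|D.[z]| ^+ 2 - `|E.[z]| ^+ 2).
Proof.
by move=> z1; rewrite /royal_poly !(hornerD, hornerN, hornerM)
  !conj_rev_circle // !normCK; ring.
Qed.

Let size_royal_poly : (size royal_poly <= (n + n).+1)%N.
Proof.
have h (p : {poly C R}) : (size p <= n.+1)%N ->
    (size (conj_rev n p * p)%R <= (n + n).+1)%N.
  move=> sp; apply: leq_trans (size_polyMleq _ _) _.
  by have := size_conj_rev n p; move: sp; lia.
by apply: leq_trans (size_polyD _ _) _; rewrite size_polyN geq_max !h.
Qed.

Let conj_rev_royal_poly : conj_rev (n + n) royal_poly = royal_poly.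
Proof.
rewrite /royal_poly conj_revB !conj_revM ?size_conj_rev // !conj_revK //.
by congr (_ - _); rewrite mulrC.
Qed.

(** As [D] has no zero in the closed disc, [royal_poly = 0] would give x3 = x1 x2 there, which
    [hroyal] forbids. *)
Let royal_poly_neq0 : royal_poly != 0.
Proof.
apply/eqP => r0; apply: hroyal => _ [z z1 <-]; have [xi _ _ _] := hx.
split.
  have [_ _ xt _ _] := xi.
  have [z2|z2] := boolP (`|z| < 1); first exact/xt.
  apply: dist_boundary_tetrablock; apply: (tetra_inner_boundary xi).
  by apply/eqP; move: z2; rewrite -real_leNgt ?normr_real // => z2; rewrite eq_le z2 andbT.
apply/eqP; rewrite -subr_eq0; have := royal_polyE z1; rewrite r0 horner0 => /esym/eqP.
by rewrite mulf_eq0 expf_eq0 (negbTE (D_neq0 z1)).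
Qed.

Let royal_poly_sigma j : royal_poly.[sigma j] = 0.
Proof.
have [_ _ h _] := hx.
by rewrite royal_polyE ?sigma_disc // h /= subrr mulr0.
Qed.

Let royal_poly_sigma_double (j : 'I_n) : (j < k)%N -> royal_poly^`().[sigma j] = 0.
Proof.
have [_ _ h1 _ _] := hdata => jk; have [s1 _] := h1 j jk.
apply: (@nonneg_circle_double_root R _ n) => // w w1.
have w1' : `|w| <= 1 by rewrite w1.
rewrite royal_poly_circle // mulrA -exprMn [w^* * w]mulrC circle_mulJ //.
rewrite expr1n mul1r subr_ge0.
by rewrite ler_pXn2r ?nnegrE // E_le_D.
Qed.

Let node_poly_spec (Q : {poly C R}) : (size Q <= (n + n).+1)%N ->
  (forall j, Q.[sigma j] = 0) ->
  (forall j : 'I_n, (k <= j)%N -> (conj_rev (n + n) Q).[sigma j] = 0) ->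
  (forall j : 'I_n, (j < k)%N -> Q^`().[sigma j] = 0) ->
  exists c, Q = c *: node_poly.
Proof.
have [_ si h1 h2 _] := hdata => sQ Q0 Qi Qc.
apply: full_node_polynomial => // j; have [jk|jk] := ltnP j k.
  by right; split; [have [] := h1 j jk|exact: Qc].
by left; split; [have [] := h2 j jk|exact: Qi].
Qed.

Let royal_poly_node : exists2 r, r != 0 & royal_poly = r *: node_poly.
Proof.
have [||j _||r rE] := @node_poly_spec royal_poly.
- exact: size_royal_poly.
- exact: royal_poly_sigma.
- by rewrite conj_rev_royal_poly.
- exact: royal_poly_sigma_double.
exists r => //; apply: contraNneq royal_poly_neq0 => r0.
by rewrite rE r0 scale0r.
Qed.

(** Used to locate the points of the circle where |E| = |D|, the only ones at which [omega *: E - D]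
    can vanish. *)
Let royal_poly_circle_root z : `|z| = 1 -> royal_poly.[z] = 0 ->
  exists j : 'I_k, z = sigma (widen_ord hkn j).
Proof.
have [_ _ h1 h2 _] := hdata => z1; have [r r0 ->] := royal_poly_node.
have [/existsP[j /eqP zj] _|nz] := boolP [exists j, z == sigma j].
  have jk : (j < k)%N.
    rewrite ltnNge; apply/negP => /h2[]; rewrite /disc /= -zj z1.
    by rewrite ltxx.
  have e : widen_ord hkn (Ordinal jk) = j by exact: val_inj.
  by exists (Ordinal jk); rewrite e.
move/eqP; rewrite hornerZ mulf_eq0 (negbTE r0) hornerM mulf_eq0 /= => /orP[].
  rewrite horner_prod => /prodf_eq0[j _].
  by rewrite hornerXsubC subr_eq0 => zj; case/existsP: nz; exists j.
rewrite (negbTE (prod_one_subZX_neq0 _ _)) ?z1 // => j.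
have [jk|jk] := ltnP j k; last by left; have [] := h2 j jk.
right; split; first by have [] := h1 j jk.
by apply: contraNneq nz => <-; apply/existsP; exists j.
Qed.

(** Since |omega E| <= |D|, equality of [omega *: E] and [D] at an interior point makes them equal
    by the maximum principle; then |E| = |D| on the circle and [royal_poly] is 0. *)
Let Psi_denominator_disc omega z : `|omega| = 1 -> `|z| < 1 ->
  (omega *: E - D).[z] != 0.
Proof.
move=> o1 z1; rewrite !hornerE subr_eq0; apply/eqP => e.
have : omega *: E = D.
  apply: (polynomial_maximum_modulus z1); rewrite ?hornerZ ?D_neq0 ?ltW // => w w1.
  by rewrite hornerZ normrM o1 mul1r E_le_D // ltW.
move=> ED; move/negP: royal_poly_neq0; apply; apply/eqP; apply: poly_eq_circle => w w1.
by rewrite royal_poly_circle // -ED hornerZ normrM o1 mul1r subrr mulr0 horner0.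
Qed.

(** At a zero on the circle |E| = |D|, so [royal_poly] vanishes and the point is a node of the
    circle. There E / D is the corresponding value of [etat], and omega must be its conjugate. *)
Let Psi_denominator omega z : `|omega| = 1 ->
  (forall j : 'I_k, omega != (etat (widen_ord hkn j))^*) ->
  `|z| <= 1 -> (omega *: E - D).[z] != 0.
Proof.
move=> o1 oe z1; have [z2|z2] := boolP (`|z| < 1); first exact: Psi_denominator_disc.
have {z2} z2 : `|z| = 1.
  by apply/eqP; move: z2; rewrite -real_leNgt ?normr_real // => z2; rewrite eq_le z1.
rewrite !hornerE subr_eq0; apply/eqP => e.
have : royal_poly.[z] = 0.
  by rewrite royal_poly_circle // -e normrM o1 mul1r subrr mulr0.
move=> /(royal_poly_circle_root z2)[j zj].
have [_ _ h _] := hx.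
have ej : etat (widen_ord hkn j) = E.[z] / D.[z].
  by have := congr1 (fun y : C3 R => y.1.2) (h (widen_ord hkn j)); rewrite -zj xE.
move/negP: (oe j); apply; rewrite ej -e; have Ez : E.[z] != 0.
  by apply: contraTneq (D_neq0 z1) => Ez; rewrite -e Ez mulr0 eqxx.
have o0 := circle_neq0 o1.
rewrite invfM mulrCA divff // mulr1; apply/eqP.
have -> : omega^-1 = omega^* by apply: (mulfI o0); rewrite mulfV // circle_mulJ.
by rewrite conjCK.
Qed.

Let Psi_quotient omega z : `|z| <= 1 -> (omega *: E - D).[z] != 0 ->
  (x z).1.2 * omega != 1 /\
  Psi omega (x z) = (omega *: conj_rev n D - conj_rev n E).[z] / (omega *: E - D).[z].
Proof.
move=> z1; rewrite /Psi xE //= !hornerE => P0; have Dz := D_neq0 z1.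
have e : E.[z] / D.[z] * omega - 1 = (omega * E.[z] - D.[z]) / D.[z] by field.
have ne : E.[z] / D.[z] * omega - 1 != 0 by rewrite e mulf_neq0 // invr_eq0.
split; first by rewrite -subr_eq0.
by rewrite e; field; rewrite P0.
Qed.

Let flat_royal_poly (t : R) (j : 'I_k) : sigma (widen_ord hkn j) = cis t ->
  flat (fun s => royal_poly.[cis s]) t.
Proof.
move=> st; apply/flat_horner_cis; rewrite -st royal_poly_sigma.
by split=> //; apply: royal_poly_sigma_double => /=.
Qed.

(** * The two directions of the correspondence *)

Lemma Psi_comp_solution omega phi : `|omega| = 1 ->
  (forall j : 'I_k, omega != (etat (widen_ord hkn j))^*) ->
  is_Psi_comp omega x phi -> blaschke_solution hkn sigma eta rho phi.
Proof.
move=> o1 oe [_ _ phiP]; have P0 z := @Psi_denominator omega z o1 oe.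
set P := omega *: E - D in P0.
have sP : (size P <= n.+1)%N.
  apply: leq_trans (size_polyD _ _) _; rewrite size_polyN geq_max sD andbT.
  exact: leq_trans (size_scale_leq _ _) sE.
have phiE z : `|z| <= 1 ->
    phi z = (omega *: conj_rev n D - conj_rev n E).[z] / P.[z].
  by move=> z1; have [h1 h2] := Psi_quotient z1 (P0 z z1); rewrite phiP.
have oJ := circle_mulJ o1.
have [_ _ xs xp] := hx.
split.
(* The numerator omega D~ - E~ is [- omega] times the reflection of [P], because
   [omega * omega^* = 1]. *)
- apply: (@finite_blaschke_conj_rev _ _ (- omega) P) => //; first by rewrite normrN.
  move=> z z1; rewrite phiE // mulrA; congr (_ / _).
  rewrite /P conj_revB conj_revZ !hornerE mulrBr mulrA mulNr oJ; ring.
- move=> j; have s1 := sigma_disc j.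
  have [h1 h2] := Psi_quotient s1 (P0 _ s1).
  rewrite phiP //; move: h1; rewrite /Psi xs /= => h1.
  by field; rewrite subr_eq0.
- move=> j; apply: (phasar_derivative_flat _ (xp j)) => t st; split.
  + pose g (s : R) := omega%:P.[cis s] / (D * P).[cis s].
    have gc : {for t, continuous g}.
      apply: continuous_quotient_cis.
      by rewrite hornerM mulf_neq0 ?D_neq0 ?P0 ?norm_cis.
    apply: flat_le (flatMr (flat_royal_poly st) gc); near=> s.
    have c1 : `|cis s : C R| <= 1 by rewrite norm_cis.
    have Dz := D_neq0 c1; have Pz := P0 _ c1.
    rewrite le_eqVlt; apply/orP; left; apply/eqP; congr (`|_|).
    rewrite phiE // xE //= /g /royal_poly.
    move: Pz; rewrite /P !(hornerD, hornerN, hornerM, hornerZ, hornerC) => Pz.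
    by field; rewrite Pz.
  + rewrite (_ : _ \o _ = (fun s => (conj_rev n E).[cis s] / D.[cis s])).
      by apply: continuous_quotient_cis; rewrite D_neq0 ?norm_cis.
    by apply/funext => s /=; rewrite xE ?norm_cis.
  + rewrite (_ : _ \o _ = (fun s =>
      (omega *: conj_rev n D - conj_rev n E).[cis s] / P.[cis s])).
      by apply: continuous_quotient_cis; rewrite P0 ?norm_cis.
    by apply/funext => s /=; rewrite phiE ?norm_cis.
Unshelve. all: by end_near. Qed.

(** Keeps the preceding statement about every representative [phi] of the composition from being
    vacuous. *)
Lemma Psi_comp_exists omega : `|omega| = 1 ->
  (forall j : 'I_k, omega != (etat (widen_ord hkn j))^*) ->
  exists phi, is_Psi_comp omega x phi.
Proof.
move=> o1 oe; have P0 z := @Psi_denominator omega z o1 oe.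
pose p := omega *: conj_rev n D - conj_rev n E; pose q := omega *: E - D.
exists (fun z => p.[z] / q.[z]); split.
- split; last exact: (within_continuous_quotient P0).
  exists p, q; split=> //; apply: contraNneq (P0 0 _); rewrite ?normr0 ?ler01 //.
  by rewrite -/q => ->; rewrite horner0.
- have c0 : `|0 : C R| <= 1 by rewrite normr0.
  exists 0; first by rewrite /disc /= normr0 ltr01.
  by have [] := Psi_quotient c0 (P0 0 c0).
- by move=> z z1 _; have [_ ->] := Psi_quotient z1 (P0 z z1).
Qed.

Lemma blaschke_solution_Psi_comp phi : blaschke_solution hkn sigma eta rho phi ->
  exists2 omega, circle omega & is_Psi_comp omega x phi.
Proof.
move=> [[c [a [c1 a1 phiP]]] phis phip].
have [_ _ d1 d2 _] := hdata; have [xi _ xs xp] := hx.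
pose F : {poly C R} := \prod_i (1 - (a i)^* *: 'X).
pose F' : {poly C R} := \prod_i ('X - (a i)%:P).
have F'E : conj_rev n F' = F by exact: conj_rev_prodXsubC.
have sF' : (size F' <= n.+1)%N by rewrite size_prod_ord_XsubC.
have FE : conj_rev n F = F' by rewrite -F'E conj_revK.
have sF : (size F <= n.+1)%N by rewrite -F'E size_conj_rev.
have F0 z : `|z| <= 1 -> F.[z] != 0.
  by move=> z1; apply: prod_one_subZX_neq0 => // j; left; exact: a1.
have phiE z : `|z| <= 1 -> phi z = (c *: F').[z] / F.[z].
  move=> z1; rewrite phiP // prodf_div hornerZ !horner_prod mulrA.
  by congr (_ * _ / _); apply: eq_bigr => i _; rewrite !hornerE.
have cJ : c * c^* = 1 := circle_mulJ c1.
pose A := c *: (F' * D) - conj_rev n E * F.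
pose B := c *: (F' * E) - conj_rev n D * F.
have AE z : `|z| <= 1 -> A.[z] = F.[z] * D.[z] * (phi z - (x z).1.1).
  move=> z1; rewrite phiE // xE //= /A !(hornerD, hornerN, hornerM, hornerZ).
  by have h1 := F0 z z1; have h2 := D_neq0 z1; field; rewrite ?h1 ?h2.
have BE z : `|z| <= 1 -> B.[z] = F.[z] * D.[z] * (phi z * (x z).1.2 - (x z).2).
  move=> z1; rewrite phiE // xE //= /B !(hornerD, hornerN, hornerM, hornerZ).
  by have h1 := F0 z z1; have h2 := D_neq0 z1; field; rewrite ?h1 ?h2.
(* Reflection exchanges [F] with [F'] and turns [A] into a multiple of [B]. The zeros of [B] thus
   supply the condition on the reflection of [A] at the nodes in the disc. *)
have rA : conj_rev (n + n) A = - c^* *: B.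
  rewrite /A conj_revB conj_revZ !conj_revM ?size_conj_rev // conj_revK // F'E FE /B.
  by rewrite scalerBr scalerA mulNr [c^* * c]mulrC cJ scaleN1r scaleNr opprK
    addrC [E * F']mulrC [F * _]mulrC.
have phi1 z : `|z| = 1 -> `|phi z| = 1.
  move=> z1; have z1' : `|z| <= 1 by rewrite z1.
  rewrite phiE // hornerZ -FE conj_rev_circle // !normrM c1 normrX z1 expr1n !mul1r.
  by rewrite norm_conjC normfV divff // normr_eq0 F0.
have x1E z : `|z| = 1 -> `|(x z).1.1| = `|E.[z]| / `|D.[z]|.
  move=> z1; rewrite xE ?z1 //= conj_rev_circle // !normrM normrX z1 expr1n mul1r.
  by rewrite norm_conjC normfV.
have [|j|j jk|j jk|al0 AN] := @node_poly_spec A.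
- have h (p q : {poly C R}) : (size p <= n.+1)%N -> (size q <= n.+1)%N ->
      (size (p * q)%R <= (n + n).+1)%N.
    by move=> sp sq; apply: leq_trans (size_polyMleq _ _) _; move: sp sq; lia.
  apply: leq_trans (size_polyD _ _) _; rewrite size_polyN geq_max.
  by rewrite (leq_trans (size_scale_leq _ _)) ?h // size_conj_rev.
- by rewrite AE ?sigma_disc // phis xs /= subrr mulr0.
- by rewrite rA hornerZ BE ?sigma_disc // phis xs /= subrr !mulr0.
(* At a node of the circle, [phi] and x1 share their value and phasar derivative. As both moduli are
   flat against 1, the difference is flat, which is the double zero of [A]. *)
- have [s1 e1] := d1 j jk; have [t _ st] := circle_cis s1.
  pose j' := Ordinal jk; have jE : widen_ord hkn j' = j by exact: val_inj.
  have := phip j'; have := xp j'; rewrite jE => xpj ppj.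
  have fl0 : flat (fun s => 1 - `|phi (cis s)|) t.
    have : flat (fun s => (0 : {poly C R}).[cis s]) t.
      by apply/flat_horner_cis; rewrite deriv0 !horner0.
    by apply: flat_le; near=> s; rewrite phi1 ?norm_cis // subrr normr0.
  have fl1 : flat (fun s => 1 - `|(x (cis s)).1.1|) t.
    pose g (s : R) := (1%:P : {poly C R}).[cis s] / (D * D).[cis s].
    have gc : {for t, continuous g}.
      apply: continuous_quotient_cis.
      by rewrite hornerM mulf_neq0 ?D_neq0 ?norm_cis.
    have sj : sigma (widen_ord hkn j') = cis t by rewrite jE.
    apply: flat_le (flatMr (flat_royal_poly sj) gc); near=> s.
    have n1 := norm_cis s : `|cis s| = 1 :> C R.
    have c1' : `|cis s : C R| <= 1 by rewrite n1.
    have Dz : `|D.[cis s]| != 0 by rewrite normr_eq0 D_neq0.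
    (* With d = |D| and e = |E|, the comparison is 1 - e / d <= (d^2 - e^2) / d^2, whose right side
       is the modulus of R / D^2; the gap is (1 - e / d) (e / d). *)
    rewrite x1E // royal_poly_circle // /g hornerC hornerM.
    rewrite !normrM normrX n1 expr1n !mul1r normfV normrM.
    set d := `|D.[_]| in Dz *; set e := `|E.[_]|.
    have d0 : 0 < d by rewrite lt_def Dz; exact: normr_ge0.
    have e0 : 0 <= e by exact: normr_ge0.
    have ed : e <= d by exact: (E_le_D c1').
    have q1 : 0 <= 1 - e / d by rewrite subr_ge0 ler_pdivrMr // mul1r.
    have q2 : 0 <= d ^+ 2 - e ^+ 2 by rewrite subr_ge0 ler_pXn2r ?nnegrE // ltW.
    rewrite (ger0_norm q1) (ger0_norm q2) -subr_ge0.
    rewrite normr1 [X in 0 <= X](_ : _ = (1 - e / d) * (e / d)); last by field.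
    by rewrite mulr_ge0 // divr_ge0 // ltW.
  have pe : phi (sigma j) = (fun z => (x z).1.1) (sigma j) by rewrite phis /= xs.
  have p1 : `|phi (sigma j)| = 1 by rewrite phi1.
  have fl := flat_of_phasar st ppj xpj pe p1 fl0 fl1.
  have : flat (fun s => A.[cis s]) t.
    pose g (s : R) := (F * D).[cis s] / (1%:P : {poly C R}).[cis s].
    have gc : {for t, continuous g}.
      by apply: continuous_quotient_cis; rewrite hornerC oner_eq0.
    apply: flat_le (flatMr fl gc); near=> s.
    rewrite AE ?norm_cis // /g hornerC divr1 hornerM mulrC //.
  by move=> /flat_horner_cis[_]; rewrite -st.
have [r r0 RN] := royal_poly_node.
pose al := al0 / r.
have AR : A = al *: royal_poly by rewrite RN scalerA divfK.
(* Otherwise phi = x1, so |x1| = 1 on the circle, that is |E| = |D|, and [royal_poly] would be 0. *)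
have al_neq0 : al != 0.
  apply: contraNneq royal_poly_neq0 => al_0; apply/eqP/poly_eq_circle => z z1.
  have z1' : `|z| <= 1 by rewrite z1.
  have Dz := D_neq0 z1'.
  have : A.[z] = 0 by rewrite AR al_0 scale0r horner0.
  rewrite AE // => /eqP; rewrite !mulf_eq0 (negbTE (F0 z z1')) (negbTE Dz) /= subr_eq0.
  move=> /eqP/(congr1 Num.norm); rewrite phi1 // x1E // => e.
  have nD : `|D.[z]| != 0 by rewrite normr_eq0.
  by rewrite royal_poly_circle // horner0 -(divfK nD `|E.[z]|) -e mul1r subrr mulr0.
have BR : B = - (c * al^*) *: royal_poly.
  have : - c^* *: B = al^* *: royal_poly.
    by rewrite -rA AR conj_revZ conj_rev_royal_poly.
  move=> /(congr1 (fun p => - c *: p)); rewrite !scalerA mulrNN cJ scale1r => ->.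
  by rewrite mulNr.
have c0 := circle_neq0 c1.
(* The ratio of the coefficients of [A] and [B] along [royal_poly]; it is unimodular since |c| = 1
   and [al], [al^*] have the same modulus. *)
pose omega := - (al / (c * al^*)).
have alJ : al^* != 0 by rewrite fmorph_eq0.
have o1 : `|omega| = 1.
  rewrite /omega; move: al al_neq0 {AR BR alJ omega} => al al_neq0.
  by rewrite normrN normf_div normrM c1 mul1r norm_conjC divff // normr_eq0.
have ABE : A = omega *: B.
  rewrite AR BR scalerA; congr (_ *: _); rewrite /omega.
  by field; rewrite c0 alJ.
have key z : `|z| <= 1 -> phi z * ((x z).1.2 * omega - 1) = (x z).2 * omega - (x z).1.1.
  move=> z1; have := congr1 (horner^~ z) ABE; rewrite hornerZ AE // BE // => e.
  have FD : F.[z] * D.[z] != 0 by rewrite mulf_neq0 ?F0 ?D_neq0.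
  have : phi z - (x z).1.1 = omega * (phi z * (x z).1.2 - (x z).2).
    by apply: (mulfI FD); rewrite e; ring.
  move=> e2; apply/eqP; rewrite -subr_eq0; apply/eqP.
  transitivity (omega * (phi z * (x z).1.2 - (x z).2) - (phi z - (x z).1.1));
    first by ring.
  by rewrite e2 subrr.
exists omega => //; split.
- split; last exact: (within_continuous_quotient F0 phiE).
  exists (c *: F'), F; split; last by move=> z z1 _; exact: phiE.
  by apply: contraNneq (F0 0 _); rewrite ?normr0 ?ler01 // => ->; rewrite horner0.
(* This [omega] is not known to avoid the excluded values, but inside the open disc the denominator
   is nonzero for every unimodular omega. *)
- have d0 : `|0 : C R| < 1 by rewrite normr0 ltr01.
  exists 0 => //; have [] // := @Psi_quotient omega 0 (ltW d0).
  exact: Psi_denominator_disc.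
- move=> z z1 ne; rewrite /Psi -key // mulfK // subr_eq0 //.
Unshelve. all: by end_near. Qed.

End RoyalInterpolation.

Theorem corollary6p5 (R : realType) (n k : nat) (hkn : (k <= n)%N)
    (sigma eta : 'I_n -> C R) (rho : 'I_k -> R)
    (hdata : blaschke_data hkn sigma eta rho)
    (etat : 'I_n -> C R) (hetat : forall j : 'I_n, closed_disc (etat j))
    (x : C R -> C3 R) (hx : royal_solution hkn sigma eta etat rho x)
    (hroyal : ~ (x @` closed_disc `<=` royal_variety)) :
  (forall omega : C R, circle omega ->
     (forall j : 'I_k, omega != (etat (widen_ord hkn j))^*) ->
     (exists phi : C R -> C R, is_Psi_comp omega x phi) /\
     (forall phi : C R -> C R, is_Psi_comp omega x phi ->
        blaschke_solution hkn sigma eta rho phi)) /\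
  (forall phi : C R -> C R, blaschke_solution hkn sigma eta rho phi ->
     exists2 omega : C R, circle omega & is_Psi_comp omega x phi).
Proof.
have [xi xd _ _] := hx.
have [D [E [sD sE D0 xE]]] := tetra_inner_structure xi xd.
split=> [omega o1 oe|phi phiP].
  split; first exact: (Psi_comp_exists hdata hx hroyal sD sE D0 xE).
  by move=> phi; exact: (Psi_comp_solution hdata hx hroyal sD sE D0 xE).
exact: (blaschke_solution_Psi_comp hdata hx hroyal sD sE D0 xE).
Qed.
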